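(* Let $P$ be the transition kernel of a $\pi$-irreducible Markov chain that is reversible with respect to its invariant probability measure $\pi$ and non-negative definite. Assume that there exists a set $A\in\mathscr{B}(X)$ with $\pi(A)>0$ such that, for some constant $\delta>0$ and some probability measure $\nu$ on $\mathscr{B}(X)$, $$P(x,B)\ge\delta 1_A(x)\nu(B),\qquad x\in X,\ B\in\mathscr{B}(X),$$ and $M:=\sup_{x\in X}\mathbb{E}_x[\sigma_A]<\infty$. Then for all $1<\lambda<e^{1/M}$ satisfying $\lambda<(1+\delta\lambda)(1-M\log\lambda)$ (and all $n$), $$\|P^n-\pi\|\le(D_2+E_2n)\lambda^{-n},$$ where $$D_2=C_2+(2-C_2)^+\lambda^{-1}M_2,\qquad E_2=C_2(1-\lambda^{-1})M_2,$$ $$C_2=\bigl((\delta\pi(A))^{-1}-1\bigr)^{1/2},\qquad M_2=\frac{\delta\lambda}{(1+\delta\lambda)(1-M\log\lambda)-\lambda}.$$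
   Context: $\Phi=\{\Phi_n:n\in\mathbb{Z}_+\}$ is a discrete-time homogeneous Markov chain on a general state space $X$ with countably generated $\sigma$-field $\mathscr{B}(X)$ and $n$-step transition kernel $P^n(x,B)=\mathbb{P}_x\{\Phi_n\in B\}$; $\mathbb{P}_x,\mathbb{E}_x$ are probability and expectation given $\Phi_0=x$. The chain has a (unique) invariant probability measure $\pi$ and is $\pi$-irreducible: if $\pi(B)>0$, there exists $n\in\mathbb{N}$ such that $P^n(x,B)>0$ for all $x\in X$. It is assumed that $P^n(x,\cdot)\ll\pi$ ($n\ge1$), with density $p^n(x,y)$. Reversible: $\pi(dx)P(x,dy)=\pi(dy)P(y,dx)$. Non-negative definite: $\int_X f(x)Pf(x)\,\pi(dx)\ge0$ for all $f\in L^2(\pi,X)$, where $Pf(x)=\int f(y)P(x,dy)$. $\sigma_A=\inf\{n\ge0:\Phi_n\in A\}$. $\|P^n-\pi\|=\sup_{x\in X}\|P^n(x,\cdot)-\pi\|_{\mathrm{Var}}$, where $\|\mu\|_{\mathrm{Var}}=\sup_{|f|\le1}|\mu(f)|$ for a signed measure $\mu$. $a^+=\max\{a,0\}$. *)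

(* Defs.v *)
(* MathComp-Analysis; the reals are an arbitrary R : realType. *)
From HB Require Import structures.
From mathcomp Require Export all_boot all_order all_algebra.
From mathcomp Require Export all_classical all_reals all_analysis.

Set Implicit Arguments.
Unset Strict Implicit.
Unset Printing Implicit Defensive.

Export Order.TTheory GRing.Theory Num.Theory.
Export numFieldNormedType.Exports.

Local Open Scope classical_set_scope.
Local Open Scope ring_scope.
Local Open Scope ereal_scope.

Definition countably_generated d (X : measurableType d) : Prop :=
  exists2 G : set (set X), countable G & @measurable d X = <<s G >>.

Definition natural_filtration dO d (Omega : measurableType dO)
    (X : measurableType d) (Phi : nat -> Omega -> X) (n : nat) :
    set (set Omega) :=
  <<s \bigcup_(k in [set k | (k <= n)%N])
        preimage_set_system [set: Omega] (Phi k) measurable >>.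

(* The chain is realized on an arbitrary measurable space Omega carrying a law
   Pr x for every starting point x. The initial condition is expressed with the
   Dirac measure because singletons of X need not be measurable. The last field
   says that Pr x (Phi_{n+1} \in B | Phi_0, ..., Phi_n) = P (Phi_n) B. *)
Record markov_chain dO d (Omega : measurableType dO) (X : measurableType d)
    (R : realType) (P : R.-pker X ~> X) (Pr : X -> probability Omega R)
    (Phi : nat -> {mfun Omega >-> X}) : Prop := MarkovChain {
  chain_start : forall (x : X) (B : set X), measurable B ->
    Pr x (Phi 0%N @^-1` B) = \d_x B ;
  chain_step : forall (x : X) (n : nat) (F : set Omega) (B : set X),
    natural_filtration Phi n F -> measurable B ->
    Pr x (F `&` Phi n.+1 @^-1` B) = \int[Pr x]_(w in F) P (Phi n w) B }.

(* P^n(x, .) is the law of Phi_n under Pr x. *)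
Definition nstep dO d (Omega : measurableType dO) (X : measurableType d)
    (R : realType) (Pr : X -> probability Omega R)
    (Phi : nat -> {mfun Omega >-> X}) (n : nat) (x : X) : probability X R :=
  distribution (Pr x) (Phi n).

Definition invariant_probability d (X : measurableType d) (R : realType)
    (P : R.-pker X ~> X) (pi : probability X R) : Prop :=
  forall B : set X, measurable B -> \int[pi]_x P x B = pi B.

Definition unique_invariant_probability d (X : measurableType d)
    (R : realType) (P : R.-pker X ~> X) (pi : probability X R) : Prop :=
  invariant_probability P pi /\
  forall mu : probability X R, invariant_probability P mu ->
    forall B : set X, measurable B -> mu B = pi B.

(* The integer n may depend on x, as is usual for pi-irreducibility. *)
Definition irreducible_wrt d (X : measurableType d) (R : realType)
    (Pn : nat -> X -> probability X R) (pi : probability X R) : Prop :=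
  forall B : set X, measurable B -> 0 < pi B ->
    forall x : X, exists2 n : nat, (0 < n)%N & 0 < Pn n x B.

(* Equality of the measures pi(dx)P(x,dy) and pi(dy)P(y,dx) on X * X. *)
Definition reversible d (X : measurableType d) (R : realType)
    (P : R.-pker X ~> X) (pi : probability X R) : Prop :=
  forall C : set (X * X), measurable C ->
    \int[pi]_x P x (xsection C x) = \int[pi]_y P y (ysection C y).

(* For f in L^2(pi), invariance makes f integrable with respect to P x for
   pi-almost every x; the inner integral is not meaningful elsewhere. *)
Definition nonneg_definite d (X : measurableType d) (R : realType)
    (P : R.-pker X ~> X) (pi : probability X R) : Prop :=
  forall f : X -> R, f \in Lfun pi 2%:E ->
    0 <= \int[pi]_x ((f x)%:E * \int[P x]_y (f y)%:E).

(* sigma_A = inf {n >= 0 | Phi_n \in A}, equal to +oo if A is never hit. *)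
Definition hitting_time dO d (Omega : measurableType dO)
    (X : measurableType d) (R : realType) (Phi : nat -> Omega -> X)
    (A : set X) (w : Omega) : \bar R :=
  ereal_inf [set n%:R%:E | n in [set n : nat | A (Phi n w)]].

(* ||mu - nu||_Var = sup over measurable |f| <= 1 of |mu(f) - nu(f)|; there is
   no factor 1/2. *)
Definition var_dist d (X : measurableType d) (R : realType)
    (mu nu : probability X R) : \bar R :=
  ereal_sup [set `| \int[mu]_x (f x)%:E - \int[nu]_x (f x)%:E | |
    f in [set f : X -> R | measurable_fun [set: X] f /\
                           forall x, (`|f x| <= 1)%R]].

Definition kernel_dist d (X : measurableType d) (R : realType)
    (K : X -> probability X R) (pi : probability X R) : \bar R :=
  ereal_sup (range (fun x => var_dist (K x) pi)).

Local Close Scope ereal_scope.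

Section constants.
Context {R : realType}.
(* piA, M and lam stand for pi(A), sup_x E_x[sigma_A] and lambda. *)
Variables (delta piA M lam : R).

Definition C2 : R := Num.sqrt ((delta * piA)^-1 - 1).

Definition M2 : R :=
  delta * lam / ((1 + delta * lam) * (1 - M * ln lam) - lam).

Definition D2 : R := C2 + Num.max (2 - C2) 0 * lam^-1 * M2.

Definition E2 : R := C2 * (1 - lam^-1) * M2.

End constants.

(* Main.v *)
Require Import Defs.
From mathcomp Require Import measurable_realfun measurable_fun_approximation.
From mathcomp Require Import simple_functions finmap ring lra.
Import HBSimple HBNNSimple.

Set Implicit Arguments.
Unset Strict Implicit.
Unset Printing Implicit Defensive.

Local Open Scope classical_set_scope.
Local Open Scope ring_scope.

(* Let Q = P - delta 1_A nu be the residual kernel. An affine function V of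
   x |-> E_x sigma_A satisfies 1 <= V <= M_2 / lam and Q V <= V / lam, so
   sum_n z^n Q^n converges in sup norm for z < lam. Hence (1 - z P) g = f is
   solvable among bounded centered functions for every 1 <= z < lam, with a
   sup-norm bound. Since P is symmetric, log-convexity of
   k |-> ||(1 - z P)^(-k) f||_2 turns this into the same bound in L^2(pi), so
   1/z is not in the spectrum of P on centered functions; as P is non-negative
   definite, its norm there is at most 1 / lam. As nu <= pi / (delta pi(A)),
   this gives |nu P^n f - pi f| <= C_2 lam^(-n) for |f| <= 1, and the identity
   P = Q + delta 1_A nu propagates the bound to all starting points. *)

(** * Positive semidefinite forms and a contraction criterion *)

(** The final estimate is uniform in the starting point, whereas $\pi$ sees points only up to null
    sets. Hence all functions are everywhere defined and bounded, and $L^2(\pi)$ enters only through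
    the possibly degenerate form $\pi(fg)$. This space need not be complete in $L^2(\pi)$, so the
    spectral step is carried out with Cauchy-Schwarz inequalities and a supremum of Rayleigh
    quotients.

    The logarithm in the condition on $\lambda$ comes from $1-\lambda^{-1}\le\log\lambda$: the drift
    function is bounded by $h=1/(1-(1-\lambda^{-1})M)\le 1/(1-M\log\lambda)$, and the condition
    yields $\lambda(1-\delta)h\le 1$, which is the drift inequality on $A$. The factor $n$ in the
    bound appears because the terms brought in by regeneration and the residual kernel decay at the
    same rate $\lambda^{-n}$. *)

Section psd_form.
Context (R : realType) (V : lmodType R) (D : set V).

Definition lin_closed := forall a f g, D f -> D g -> D (a *: f + g).

(** Nonzero vectors of zero norm are allowed, so $\pi(fg)$ qualifies without passing to classes
    modulo null functions. *)
Record psd_form (b : V -> V -> R) : Prop := PsdForm {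
  psd_lin : forall a f g h, D f -> D g -> D h ->
    b (a *: f + g) h = a * b f h + b g h ;
  psd_sym : forall f g, D f -> D g -> b f g = b g f ;
  psd_ge0 : forall f, D f -> 0 <= b f f }.

Lemma psd_form_CS (b : V -> V -> R) (f g : V) : lin_closed -> psd_form b ->
  D f -> D g -> b f g ^+ 2 <= b f f * b g g.
Proof.
move=> DL [bL bS b0] Df Dg.
have quad (t : R) : 0 <= t ^+ 2 * b f f + 2 * t * b f g + b g g.
  have Dh : D (t *: f + g) by exact: DL.
  have := b0 _ Dh; rewrite bL// (bS f)// (bS g)// !bL// (bS g f)//.
  by congr (_ <= _); ring.
have := b0 _ Df; rewrite le_eqVlt => /orP[/eqP bff0|bff0].
  rewrite -bff0 mul0r.
  have [->|bfg0] := eqVneq (b f g) 0; first by rewrite expr0n.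
  (* With [b f f = 0] the quadratic is affine in [t]; at this [t] it equals -1. *)
  have := quad (- (b g g + 1) / (2 * b f g)).
  rewrite -bff0 mulr0 add0r.
  have -> : 2 * (- (b g g + 1) / (2 * b f g)) * b f g = - (b g g + 1).
    by field.
  lra.
have := quad (- b f g / b f f).
have -> : (- b f g / b f f) ^+ 2 * b f f + 2 * (- b f g / b f f) * b f g
   = - (b f g ^+ 2) / b f f by field; rewrite gt_eqF.
rewrite mulNr addrC subr_ge0 ler_pdivrMr// mulrC//.
Qed.

End psd_form.

(* A log-convex sequence has increasing successive ratios, and these are at
   most its exponential growth rate. *)
Lemma log_convex_ratio (R : realType) (b : nat -> R) (K G : R) :
  0 < G -> (forall k, 0 <= b k) ->
  (forall k, b k.+1 ^+ 2 <= b k * b k.+2) ->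
  (forall k, b k <= K * G ^+ k) -> b 1%N <= G * b 0%N.
Proof.
move=> G0 b0 bc bG; rewrite leNgt; apply/negP => Gb.
have b1 : 0 < b 1%N by rewrite (le_lt_trans _ Gb)// mulr_ge0// ltW.
have b00 : 0 < b 0%N.
  rewrite lt_neqAle b0 andbT eq_sym; apply/eqP => b00.
  have := bc 0%N; rewrite b00 mul0r leNgt => /negP; apply.
  by rewrite exprn_gt0.
pose r := b 1%N / b 0%N.
have r0 : 0 < r by rewrite divr_gt0.
have Gr : G < r by rewrite ltr_pdivlMr.
have step k : 0 < b k /\ r * b k <= b k.+1.
  elim: k => [|k [bk IH]]; first by rewrite b00 /r divfK// gt_eqF.
  have bk1 : 0 < b k.+1 by rewrite (lt_le_trans _ IH)// mulr_gt0.
  split => //.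
  have := bc k; rewrite expr2 => bck.
  rewrite -(ler_pM2l bk) (le_trans _ bck)// mulrA (mulrC (b k)).
  by rewrite ler_wpM2r.
have lower k : b 0%N * r ^+ k <= b k.
  elim: k => [|k IH]; first by rewrite mulr1.
  rewrite exprS mulrCA (le_trans _ (step k).2)// ler_wpM2l// ltW//.
have big k : (r / G) ^+ k <= K / b 0%N.
  rewrite ler_pdivlMr// expr_div_n mulrAC ler_pdivrMr ?exprn_gt0//.
  by rewrite mulrC (le_trans (lower k)).
have rG1 : 1 < r / G by rewrite ltr_pdivlMr// mul1r.
(* Bernoulli's inequality makes the powers of [r / G > 1] unbounded, against [big]. *)
have bern k : 1 + k%:R * (r / G - 1) <= (r / G) ^+ k.
  elim: k => [|k IH]; first by rewrite mul0r addr0.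
  rewrite exprS (@le_trans _ _ ((r / G) * (1 + k%:R * (r / G - 1))))//.
    rewrite -natr1 -subr_ge0.
    have -> : r / G * (1 + k%:R * (r / G - 1)) - (1 + (k%:R + 1) * (r / G - 1))
      = k%:R * (r / G - 1) ^+ 2 by ring.
    by rewrite mulr_ge0// sqr_ge0.
  by rewrite ler_wpM2l// (le_trans _ (ltW rG1)).
pose y := K / b 0%N / (r / G - 1).
have [k yk] : exists k : nat, y < k%:R.
  exists (Num.bound `|y|); rewrite (le_lt_trans (ler_norm _))//.
  exact: archi_boundP.
have := le_trans (bern k) (big k).
move: yk; rewrite /y ltr_pdivrMr ?subr_gt0// => yk; lra.
Qed.

(** * Symmetric nonnegative operators with a solvable resolvent equation *)

Section reversible_contraction.
Context (R : realType) (V : lmodType R) (D : set V) (ip : V -> V -> R).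
Context (T : V -> V) (N : V -> R) (lam : R).
Hypotheses (lam_gt1 : 1 < lam) (D_lin : lin_closed D) (ip_psd : psd_form D ip).
Hypothesis T_stable : forall f, D f -> D (T f).
Hypothesis T_sym : forall f g, D f -> D g -> ip (T f) g = ip f (T g).
Hypothesis T_ge0 : forall f, D f -> 0 <= ip f (T f).
Hypothesis T_le1 : forall f, D f -> ip f (T f) <= ip f f.
Hypothesis ip_le : forall f, D f -> ip f f <= N f ^+ 2.
Hypothesis N_ge0 : forall f, 0 <= N f.
Hypothesis solvable : forall z, 1 <= z -> z < lam -> exists2 C, 0 < C &
  forall f, D f -> exists2 g, D g & g - z *: T g = f /\ N g <= C * N f.

Let D_resolvent z f : D f -> D (f - z *: T f).
Proof. by move=> Df; rewrite addrC -scaleNr; apply: D_lin => //; exact: T_stable. Qed.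

Let ip_linr a f g h : D f -> D g -> D h ->
  ip h (a *: f + g) = a * ip h f + ip h g.
Proof.
case: ip_psd => L S _ Df Dg Dh.
by rewrite S// ?L// ?(S _ h)//; exact: D_lin.
Qed.

Let ip_resolventl z f g : D f -> D g ->
  ip (f - z *: T f) g = ip f g - z * ip (T f) g.
Proof.
move=> Df Dg; rewrite addrC -scaleNr (psd_lin ip_psd)//; last exact: T_stable.
by rewrite mulNr addrC.
Qed.

Let ip_resolventr z f g : D f -> D g ->
  ip g (f - z *: T f) = ip g f - z * ip g (T f).
Proof.
move=> Df Dg; rewrite addrC -scaleNr ip_linr//; last exact: T_stable.
by rewrite mulNr addrC.
Qed.

(* Iterating the sup-norm solution operator of [1 - zT], symmetric for [ip],
   turns its sup-norm bound into the same bound for the [ip]-norm. *)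
Lemma resolvent_lower_bound z : 1 <= z -> z < lam -> exists2 C, 1 <= C &
  forall g, D g -> ip g g <= C ^+ 2 * ip (g - z *: T g) (g - z *: T g).
Proof.
(* The added 1 makes the constant at least 1, so that $1-C^{-2}\ge 0$ in the Rayleigh quotient
   argument. *)
move=> z1 zl; have [C C0 sol] := solvable z1 zl; exists (1 + C) => [|g Dg].
  by rewrite lerDl ltW.
have inv f : exists g, D f -> [/\ D g, g - z *: T g = f & N g <= C * N f].
  have [Df|nDf] := pselect (D f); last by exists f => /nDf.
  by have [g' ? [? ?]] := sol _ Df; exists g'.
pose S f := sval (cid (inv f)).
have SP f : D f -> [/\ D (S f), S f - z *: T (S f) = f & N (S f) <= C * N f].
  by move=> Df; exact: (svalP (cid (inv f)) Df).
(* Here [f k] is $(1-zT)^{1-k}g$: the sequence starts one step before [g], so that the first ratio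
   [b 1 / b 0] is the quantity to be bounded. *)
pose f k := if k is k'.+1 then iter k' S g else g - z *: T g.
have Df k : D (f k).
  elim: k => [|[|k] IH] //=; first exact: D_resolvent.
  by have [] := SP _ IH.
have fS k : f k.+1 - z *: T (f k.+1) = f k.
  case: k => [|k] //=; by have [] := SP _ (Df k.+1).
have Nf k : N (f k.+1) <= C ^+ k * N g.
  elim: k => [|k IH] /=; first by rewrite mul1r.
  have [_ _ le1] := SP _ (Df k.+1).
  by rewrite (le_trans le1)// exprS -mulrA ler_wpM2l// ltW.
pose b k := ip (f k) (f k).
have bc k : b k.+1 ^+ 2 <= b k * b k.+2.
  have -> : b k.+1 = ip (f k) (f k.+2).
    rewrite /b -{2}(fS k.+1) -(fS k) ip_resolventr// ip_resolventl//.
    by rewrite T_sym.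
  exact: (psd_form_CS D_lin ip_psd (Df k) (Df k.+2)).
(* For $k\ge 1$ the estimate in [N] gives $(C^{k-1}N(g))^2$, hence the division by [C ^+ 2]; the
   summand [b 0] covers $k=0$. *)
have bG k : b k <= (N g ^+ 2 / C ^+ 2 + b 0%N) * (C ^+ 2) ^+ k.
  have Ck m : 0 <= (C ^+ 2) ^+ m by rewrite exprn_ge0// exprn_ge0// ltW.
  have b0 : 0 <= b 0%N by exact: (psd_ge0 ip_psd (Df 0%N)).
  case: k => [|k]; first by rewrite mulr1 lerDr divr_ge0// sqr_ge0.
  rewrite mulrDl -[leLHS]addr0 lerD ?mulr_ge0//.
  rewrite (le_trans (ip_le (Df _)))// (exprS (C ^+ 2)) mulrA.
  rewrite divfK ?gt_eqF ?exprn_gt0//.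
  rewrite mulrC -exprM mulnC exprM -exprMn ler_sqr ?nnegrE//.
  by rewrite mulr_ge0// exprn_ge0// ltW.
have C20 : 0 < C ^+ 2 by rewrite exprn_gt0.
have b0 k : 0 <= b k by exact: (psd_ge0 ip_psd (Df k)).
rewrite (le_trans (log_convex_ratio C20 b0 bc bG))// ler_wpM2r//.
by rewrite ler_sqr ?nnegrE ?addr_ge0 ?ler_wpDl// ltW.
Qed.

(** If the supremum $s$ of the Rayleigh quotients exceeded $\lambda^{-1}$, then $z=1/s$ would lie in
    $[1,\lambda)$ and $S=1-zT$ would satisfy $0\le S\le 1$. Then $\langle g,Sg\rangle\ge\|Sg\|^2\ge
    C^{-2}\|g\|^2$, so every Rayleigh quotient would be at most $s(1-C^{-2})<s$. *)
Lemma form_le f : D f -> ip f (T f) <= lam^-1 * ip f f.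
Proof.
have l0 : 0 < lam by exact: lt_trans lam_gt1.
(* On vectors of zero norm the quotient is 0, since the inverse of 0 is 0. *)
pose E := [set ip f (T f) / ip f f | f in D].
move=> Df.
have Eub : ubound E 1.
  move=> _ [g Dg <-].
  have := psd_ge0 ip_psd Dg; rewrite (le_eqVlt 0) => /orP[/eqP <-|g0].
    by rewrite invr0 mulr0.
  by rewrite ler_pdivrMr// mul1r T_le1.
have supE : has_sup E by split; [exists (ip f (T f) / ip f f), f|exists 1].
have leE g : D g -> ip g (T g) <= sup E * ip g g.
  move=> Dg.
  have := psd_ge0 ip_psd Dg; rewrite (le_eqVlt 0) => /orP[/eqP g0|g0].
    by rewrite -g0 mulr0 g0 T_le1.
  rewrite -ler_pdivrMr//; apply: (ub_le_sup supE.2); by exists g.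
have [sl|ls] := leP (sup E) lam^-1.
  by rewrite (le_trans (leE _ Df))// ler_wpM2r//; exact: (psd_ge0 ip_psd).
have s0 : 0 < sup E by rewrite (lt_trans _ ls)// invr_gt0.
have s1 : sup E <= 1 by apply: ge_sup => //; exact: supE.1.
have z1 : 1 <= (sup E)^-1 by rewrite invf_ge1.
have zl : (sup E)^-1 < lam by rewrite invf_plt ?posrE.
have [C C1 CP] := resolvent_lower_bound z1 zl.
set z := (sup E)^-1 in z1 zl CP.
have z0 : 0 < z by rewrite invr_gt0.
pose Sz g := g - z *: T g.
have DS g : D g -> D (Sz g) by exact: D_resolvent.
have psdS : psd_form D (fun g h => ip g (Sz h)).
  split=> [a g h k Dg Dh Dk|g h Dg Dh|g Dg].
  - by rewrite (psd_lin ip_psd)//; exact: DS.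
  - rewrite /Sz !ip_resolventr// -T_sym// (psd_sym ip_psd Dg Dh) (psd_sym ip_psd _ Dh)//.
    exact: T_stable.
  - rewrite ip_resolventr// subr_ge0 -ler_pdivlMl// /z invrK.
    exact: leE.
(* This is $S^2\le S$. Cauchy-Schwarz for the form $\langle g,Sh\rangle$ gives $\|Sg\|^4\le\langle
   Sg,S^2g\rangle\langle g,Sg\rangle$, and $\langle Sg,S^2g\rangle\le\|Sg\|^2$ because [T] is
   nonnegative. *)
have SSle g : D g -> ip (Sz g) (Sz g) <= ip g (Sz g).
  move=> Dg; set y := ip _ _ .
  have y0 : 0 <= y by apply: (psd_ge0 ip_psd); exact: DS.
  have := psd_form_CS D_lin psdS (DS _ Dg) Dg; rewrite -/y /=.
  have : ip (Sz g) (Sz (Sz g)) <= y.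
    rewrite {2}/Sz ip_resolventr; [|exact: DS..].
    by rewrite gerBl mulr_ge0 ?(ltW z0)// T_ge0//; exact: DS.
  have := psd_ge0 psdS Dg => /= p0 le1 le2.
  move: y0; rewrite (le_eqVlt 0) => /orP[/eqP<-//|y0].
  rewrite -(ler_pM2l y0) -expr2 (le_trans le2)// ler_wpM2r//.
have C20 : 0 < C ^+ 2 by rewrite exprn_gt0// (lt_le_trans ltr01).
have le2 g : D g -> ip g (T g) <= sup E * (1 - (C ^+ 2)^-1) * ip g g.
  move=> Dg; have := CP _ Dg => /le_trans /(_ (ler_wpM2l (ltW C20) (SSle _ Dg))).
  rewrite -ler_pdivrMl// ip_resolventr// => le3.
  rewrite -mulrA -ler_pdivrMl// -/z mulrBl mul1r lerBrDr addrC -lerBrDr//.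
have : sup E <= sup E * (1 - (C ^+ 2)^-1).
  apply: ge_sup; first exact: supE.1.
  move=> _ [g Dg <-].
  have := psd_ge0 ip_psd Dg; rewrite (le_eqVlt 0) => /orP[/eqP g0|g0].
    rewrite -g0 invr0 mulr0 mulr_ge0 ?(ltW s0)// subr_ge0.
    by rewrite invf_le1// exprn_ege1.
  by rewrite ler_pdivrMr// le2.
rewrite -[leLHS]mulr1 ler_pM2l// lerBrDr gerDl leNgt invr_gt0 C20//.
Qed.

(** Cauchy-Schwarz for the form $\langle g,Th\rangle$ gives $\|Tf\|^4\le\langle
    Tf,T^2f\rangle\langle f,Tf\rangle$; [form_le] applies to both factors. *)
Lemma contraction f : D f -> ip (T f) (T f) <= lam^-1 ^+ 2 * ip f f.
Proof.
move=> Df; have l0 : 0 < lam by exact: lt_trans lam_gt1.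
have psdT : psd_form D (fun g h => ip g (T h)).
  split=> [a g h k Dg Dh Dk|g h Dg Dh|g Dg].
  - by rewrite (psd_lin ip_psd)//; exact: T_stable.
  - by rewrite -T_sym// (psd_sym ip_psd)//; exact: T_stable.
  - exact: T_ge0.
set y := ip (T f) (T f).
have y0 : 0 <= y by apply: (psd_ge0 ip_psd); exact: T_stable.
have := psd_form_CS D_lin psdT (T_stable Df) Df; rewrite -/y /= => le1.
have le2 : ip (T f) (T (T f)) <= lam^-1 * y by apply/form_le/T_stable.
have le3 := form_le Df.
move: y0; rewrite (le_eqVlt 0) => /orP[/eqP<-|y0].
  by rewrite mulr_ge0 ?sqr_ge0//; exact: (psd_ge0 ip_psd).
rewrite -(ler_pM2l y0) -expr2 (le_trans le1)//.
have -> : y * (lam^-1 ^+ 2 * ip f f) = (lam^-1 * y) * (lam^-1 * ip f f).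
  by rewrite expr2; ring.
by rewrite ler_pM// T_ge0//; exact: T_stable.
Qed.

End reversible_contraction.

(** * Functionals on bounded measurable functions *)

Section bounded_measurable.
Context d (X : measurableType d) (R : realType).
Implicit Types (f g : X -> R) (u : nat -> X -> R).

Definition bmf f :=
  measurable_fun [set: X] f /\ exists c, forall x, `|f x| <= c.

(** The mode of convergence that dominated convergence turns into convergence of integrals, and that
    sub-Markov operators preserve. *)
Definition bounded_cvg u f := [/\ forall n, measurable_fun [set: X] (u n),
  exists c, forall n x, `|u n x| <= c & forall x, u n x @[n --> \oo] --> f x].

Lemma bmf_cst (a : R) : bmf (cst a).
Proof. by split; [exact: measurable_cst|exists `|a|]. Qed.

Lemma bmf_indic (B : set X) : measurable B -> bmf (\1_B : X -> R).
Proof.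
move=> mB; split; first exact: measurable_indic.
by exists 1 => x; rewrite indicE; case: (x \in B); rewrite ?normr1 ?normr0.
Qed.

Lemma bmf_lin a f g : bmf f -> bmf g -> bmf (a *: f + g).
Proof.
move=> [mf [c fc]] [mg [e ge]]; split.
  by apply: measurable_funD => //; exact: measurable_funM.
exists (`|a| * c + e) => x.
by rewrite (le_trans (ler_normD _ _))// lerD// normrM ler_wpM2l.
Qed.

Lemma bmfZ a f : bmf f -> bmf (a *: f).
Proof. by move=> bf; rewrite -[_ *: _]addr0; apply: bmf_lin => //; exact: bmf_cst. Qed.

Lemma bmfD f g : bmf f -> bmf g -> bmf (f + g).
Proof. by move=> bf bg; rewrite -[f]scale1r; exact: bmf_lin. Qed.

Lemma bmfB f g : bmf f -> bmf g -> bmf (f - g).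
Proof. by move=> bf bg; rewrite addrC -scaleN1r; exact: bmf_lin. Qed.

Lemma bmfM f g : bmf f -> bmf g -> bmf (f * g).
Proof.
move=> [mf [c fc]] [mg [e ge]]; split; first exact: measurable_funM.
by exists (c * e) => x; rewrite normrM ler_pM.
Qed.

Lemma bounded_cvg_bmf u f : bounded_cvg u f -> bmf f.
Proof.
move=> [mu [c uc] uf]; split; first by apply: measurable_fun_cvg mu _ => x _.
have clc : closed (fun y : R => `|y| <= c).
  apply: (@closed_comp _ _ (fun y : R => `|y|) [set y : R | y <= c]); last exact: closed_le.
  by move=> y _; exact: norm_continuous.
by exists c => x; apply: (closed_cvg _ clc _ _ (uf x)); exact: nearW.
Qed.

(* Nonnegative simple functions increase to [f] boundedly. *)
Lemma bmf_ge0_ind (H : (X -> R) -> Prop) :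
  (forall B, measurable B -> H \1_B) ->
  (forall a f g, 0 <= a -> bmf f -> bmf g -> H f -> H g -> H (a *: f + g)) ->
  (forall u f, bounded_cvg u f -> (forall n, H (u n)) -> H f) ->
  forall f, bmf f -> (forall x, 0 <= f x) -> H f.
Proof.
move=> Hi Hl Hc f [mf [c fc]] f0.
have H0 : H 0 by rewrite -[0]indic0; exact: Hi.
have Hs (h : {nnsfun X >-> R}) : H h.
  pose s : seq R := fset_set (range h).
  have E : (h : X -> R) = \sum_(y <- s) (y *: (\1_(h @^-1` [set y]) : X -> R)).
    apply/funext => x; rewrite fct_sumE (fimfunE h) fsbig_finite//.
  rewrite E.
  have s0 y : y \in s -> 0 <= y.
    have -> : (y \in s) = (y \in fset_set (range h)) by [].
    by rewrite in_fset_set// => /set_mem[x _ <-].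
  suff [] : bmf (\sum_(y <- s) (y *: (\1_(h @^-1` [set y]) : X -> R))) /\
      H (\sum_(y <- s) (y *: (\1_(h @^-1` [set y]) : X -> R))) by [].
  have mi y : measurable (h @^-1` [set y]) by exact: measurable_sfunP.
  elim: {E}(s : seq R) s0 => [|y r IH] r0.
    by rewrite big_nil; split => //; exact: bmf_cst.
  rewrite big_cons.
  have [|b1 H1] := IH; first by move=> z zr; apply: r0; rewrite inE zr orbT.
  split; first by apply: bmf_lin => //; exact: bmf_indic.
  apply: Hl => //; first by apply: r0; rewrite inE eqxx.
    exact: bmf_indic.
  exact: Hi.
have mEf : measurable_fun [set: X] (EFin \o f) by exact/measurable_EFinP.
pose u n : X -> R := nnsfun_approx measurableT mEf n.
have ucv x : u n x @[n --> \oo] --> f x.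
  have : EFin \o (u ^~ x) @ \oo --> (EFin \o f) x.
    by apply: (@cvg_nnsfun_approx _ _ _ _ measurableT _ mEf) => // y _; rewrite lee_fin.
  by move=> /fine_cvg.
have und x : nondecreasing_seq (u ^~ x).
  by move=> m n mn; have /lefP := nd_nnsfun_approx measurableT mEf mn; apply.
apply: (Hc u) => [|n]; last exact: Hs.
split => //; exists c => n x; rewrite ger0_norm; last exact: fun_ge0.
apply: le_trans (fc x); apply: le_trans (ler_norm _).
have -> : f x = limn (u ^~ x) by apply/esym/cvg_lim.
by apply: nondecreasing_cvgn_le => //; apply/cvg_ex; exists (f x); exact: ucv.
Qed.

(** Abstracts integration against a finite signed measure. Composites such as $f\mapsto\pi(k\cdot
    Pf)$ belong to the class, so they too are determined by their values on indicators. *)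
Record sigma_linear (L : (X -> R) -> R) : Prop := SigmaLinear {
  sl_lin : forall a f g, bmf f -> bmf g -> L (a *: f + g) = a * L f + L g ;
  sl_cvg : forall u f, bounded_cvg u f -> L (u n) @[n --> \oo] --> L f }.

Section theory.
Variables (L : (X -> R) -> R) (sL : sigma_linear L).

Lemma slD f g : bmf f -> bmf g -> L (f + g) = L f + L g.
Proof. by move=> bf bg; rewrite -[f]scale1r (sl_lin sL)// mul1r scale1r. Qed.

Lemma slB f g : bmf f -> bmf g -> L (f - g) = L f - L g.
Proof. by move=> bf bg; rewrite addrC -scaleN1r (sl_lin sL)// mulN1r addrC. Qed.

Lemma sl0 : L 0 = 0.
Proof. by rewrite -[0 in LHS](subrr 0) slB ?subrr//; exact: bmf_cst. Qed.

Lemma slZ a f : bmf f -> L (a *: f) = a * L f.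
Proof.
by move=> bf; rewrite -[a *: f]addr0 (sl_lin sL)// ?sl0 ?addr0//; exact: bmf_cst.
Qed.

Lemma sl_ge0 : (forall B, measurable B -> 0 <= L \1_B) ->
  forall f, bmf f -> (forall x, 0 <= f x) -> 0 <= L f.
Proof.
move=> LB; apply: (@bmf_ge0_ind (fun f => 0 <= L f)) => [//|a f g a0 bf bg f0 g0|u f uf u0].
  by rewrite (sl_lin sL)// addr_ge0// mulr_ge0.
have cl0 : closed (fun y : R => 0 <= y) by exact: closed_ge.
by apply: (closed_cvg _ cl0 _ _ (sl_cvg sL uf)); exact: nearW.
Qed.

Hypothesis L_ge0 : forall f, bmf f -> (forall x, 0 <= f x) -> 0 <= L f.

Lemma sl_le f g : bmf f -> bmf g -> (forall x, f x <= g x) -> L f <= L g.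
Proof.
move=> bf bg fg; rewrite -subr_ge0 -slB// L_ge0//; first exact: bmfB.
by move=> x; rewrite subr_ge0.
Qed.

Lemma sl_norm f g : bmf f -> bmf g -> (forall x, `|f x| <= g x) -> `|L f| <= L g.
Proof.
move=> bf bg fg; rewrite ler_norml -[- _]mulN1r -slZ//; apply/andP; split.
  apply: sl_le => //; first exact: bmfZ.
  by move=> x; have := fg x; rewrite ler_norml => /andP[+ _]; rewrite scaleN1r.
apply: sl_le => // x; exact: le_trans (ler_norm _) (fg x).
Qed.

End theory.

Lemma sl_uniq (L1 L2 : (X -> R) -> R) : sigma_linear L1 -> sigma_linear L2 ->
  (forall B, measurable B -> L1 \1_B = L2 \1_B) ->
  forall f, bmf f -> L1 f = L2 f.
Proof.
move=> s1 s2 L12 f bf.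
have ge0 g : bmf g -> (forall x, 0 <= g x) -> L1 g = L2 g.
  apply: (@bmf_ge0_ind (fun g => L1 g = L2 g)) => // [a h k _ bh bk hh kk|u h uh u12].
    by rewrite (sl_lin s1)// (sl_lin s2)// hh kk.
  have := sl_cvg s1 uh; have -> : (fun n => L1 (u n)) = (fun n => L2 (u n)).
    exact/funext.
  by move=> c1; exact: (cvg_unique _ c1 (sl_cvg s2 uh)).
have [mf [c fc]] := bf.
have bc := bmf_cst (`|c|).
have -> : f = (f + cst `|c|) - cst `|c| by rewrite addrK.
rewrite (slB s1)//; last exact: bmfD.
rewrite (slB s2)//; last exact: bmfD.
rewrite !ge0//; first exact: bmfD.
move=> x; rewrite /= -lerBlDr sub0r.
by have := le_trans (fc x) (ler_norm c); rewrite ler_norml => /andP[].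
Qed.

Lemma sigma_linear_lin a (L1 L2 : (X -> R) -> R) :
  sigma_linear L1 -> sigma_linear L2 -> sigma_linear (fun f => a * L1 f + L2 f).
Proof.
move=> s1 s2; split=> [b f g bf bg|u f uf].
  by rewrite (sl_lin s1)// (sl_lin s2)//; ring.
by apply: cvgD; [apply: cvgM; [exact: cvg_cst|exact: sl_cvg]|exact: sl_cvg].
Qed.

Lemma sigma_linear_weight g (L : (X -> R) -> R) :
  bmf g -> sigma_linear L -> sigma_linear (fun f => L (g * f)).
Proof.
move=> bg sL; split=> [a f h bf bh|u f uf].
  have -> : g * (a *: f + h) = a *: (g * f) + g * h.
    by apply/funext => x; rewrite !fctE mulrDr mulrCA.
  by rewrite (sl_lin sL)//; exact: bmfM.
apply: (sl_cvg sL); have [mg [e ge]] := bg; have [mu [c uc] cv] := uf; split.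
- by move=> n; exact: measurable_funM.
- by exists (e * c) => n x; rewrite normrM ler_pM.
- by move=> x; apply: cvgM; [exact: cvg_cst|exact: cv].
Qed.

End bounded_measurable.

(** * Integration as a sigma-linear functional *)

Section integral.
Context d (X : measurableType d) (R : realType).

Lemma bmf_integrable (mu : {measure set X -> \bar R}) f :
  (mu setT < +oo)%E -> bmf f -> mu.-integrable setT (EFin \o f).
Proof.
move=> muT [mf [c fc]]; apply: measurable_bounded_integrable => //.
by exists c; split; rewrite ?num_real// => y cy x _; exact: le_trans (fc x) (ltW cy).
Qed.

Lemma sigma_linear_integral (mu : {measure set X -> \bar R}) :
  (mu setT < +oo)%E -> sigma_linear (fun f => \int[mu]_x f x).
Proof.
move=> muT; split=> [a f g bf bg|u f uf].
  rewrite RintegralD//; last 2 first.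
  - by apply: bmf_integrable => //; exact: bmfZ.
  - exact: bmf_integrable.
  by rewrite RintegralZl//; exact: bmf_integrable.
have bf := bounded_cvg_bmf uf.
have [mu_ [c uc] cv] := uf.
have cc : forall x, EFin \o (u ^~ x) @ \oo --> (f x)%:E.
  by move=> x; apply/cvg_EFin; [exact: nearW|exact: cv].
have muf n : measurable_fun [set: X] (EFin \o u n) by exact/measurable_EFinP.
have mf : measurable_fun [set: X] (EFin \o f) by apply/measurable_EFinP; exact: bf.1.
have ic : mu.-integrable setT (EFin \o cst c).
  by apply: bmf_integrable => //; exact: bmf_cst.
have [| |_ _] := dominated_convergence measurableT muf mf _ ic _.
- by apply: aeW => x _; exact: cc.
- by apply: aeW => x n _; rewrite lee_fin uc.
move=> cvI; apply: fine_cvg; rewrite fineK//.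
exact: integrable_fin_num (bmf_integrable _ _).
Qed.

Lemma integral_bmf (mu : {measure set X -> \bar R}) f : (mu setT < +oo)%E -> bmf f ->
  (\int[mu]_x (f x)%:E)%E = (\int[mu]_x f x)%:E.
Proof.
move=> muT bf; rewrite fineK//.
exact: integrable_fin_num (bmf_integrable _ _).
Qed.

Lemma Rintegral_indic (mu : {measure set X -> \bar R}) B : measurable B ->
  \int[mu]_x \1_B x = fine (mu B).
Proof. by move=> mB; rewrite /Rintegral integral_indic// setIT. Qed.

End integral.

(** * Sub-Markov operators and probability functionals *)

Section kernel_operators.
Context d (X : measurableType d) (R : realType).
Implicit Types (f g : X -> R) (T S : (X -> R) -> X -> R).

(** Total mass at most 1, rather than equal to 1, so that the residual kernel is included. *)
Record kernel_op T : Prop := KernelOp {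
  ko_bmf : forall f, bmf f -> bmf (T f) ;
  ko_sl : forall x, sigma_linear (T ^~ x) ;
  ko_ge0 : forall f, bmf f -> (forall x, 0 <= f x) -> forall x, 0 <= T f x ;
  ko_le1 : forall x, T (cst 1) x <= 1 }.

Record prob_functional (L : (X -> R) -> R) : Prop := ProbFunctional {
  pf_sl : sigma_linear L ;
  pf_ge0 : forall f, bmf f -> (forall x, 0 <= f x) -> 0 <= L f ;
  pf1 : L (cst 1) = 1 }.

Section operator.
Variables (T : (X -> R) -> X -> R) (kT : kernel_op T).

Lemma ko_lin a f g : bmf f -> bmf g -> T (a *: f + g) = a *: T f + T g.
Proof.
by move=> bf bg; apply/funext => x; rewrite (sl_lin (ko_sl kT x)).
Qed.

Lemma ko_le f g x : bmf f -> bmf g -> (forall y, f y <= g y) -> T f x <= T g x.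
Proof.
move=> bf bg; apply: (sl_le (ko_sl kT x)) => // h bh h0.
exact: (ko_ge0 kT).
Qed.

Lemma ko_norm f g x : bmf f -> bmf g -> (forall y, `|f y| <= g y) ->
  `|T f x| <= T g x.
Proof.
move=> bf bg; apply: (sl_norm (ko_sl kT x)) => // h bh h0.
exact: (ko_ge0 kT).
Qed.

Lemma ko_cst_le a x : 0 <= a -> T (cst a) x <= a.
Proof.
move=> a0; have -> : cst a = a *: cst 1 :> (X -> R).
  by apply/funext => y; exact/esym/mulr1.
by rewrite (slZ (ko_sl kT x))// ?ler_piMr// ?(ko_le1 kT)//; exact: bmf_cst.
Qed.

Lemma ko_norm_cst f a x : bmf f -> (forall y, `|f y| <= a) -> `|T f x| <= a.
Proof.
move=> bf fa; have a0 : 0 <= a by rewrite (le_trans _ (fa x)).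
by rewrite (le_trans (ko_norm x bf (bmf_cst _ a) fa))// ko_cst_le.
Qed.

Lemma ko_cvg u f : bounded_cvg u f -> bounded_cvg (fun n => T (u n)) (T f).
Proof.
move=> uf; have [mu [c uc] cv] := uf.
have bu n : bmf (u n) by split => //; exists c.
split=> [n||x]; first by have [] := ko_bmf kT (bu n).
- by exists c => n x; exact: ko_norm_cst.
- exact: sl_cvg (ko_sl kT x) _ _ uf.
Qed.

Lemma sigma_linear_comp L : sigma_linear L -> sigma_linear (fun f => L (T f)).
Proof.
move=> sL; split=> [a f g bf bg|u f uf].
  by rewrite ko_lin// (sl_lin sL)//; exact: (ko_bmf kT).
exact: (sl_cvg sL (ko_cvg uf)).
Qed.

End operator.

Lemma ko_iter T n f : kernel_op T -> bmf f -> bmf (iter n T f).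
Proof. by move=> kT bf; elim: n => //= n; exact: (ko_bmf kT). Qed.

Section functional.
Variables (L : (X -> R) -> R) (pL : prob_functional L).
Let sL := pf_sl pL.

Lemma pf_cst a : L (cst a) = a.
Proof.
have -> : cst a = a *: cst 1 :> (X -> R).
  by apply/funext => y; exact/esym/mulr1.
by rewrite (slZ sL) ?(pf1 pL) ?mulr1//; exact: bmf_cst.
Qed.

Lemma pf_le f g : bmf f -> bmf g -> (forall y, f y <= g y) -> L f <= L g.
Proof. by move=> bf bg; apply: (sl_le sL) => //; exact: (pf_ge0 pL). Qed.

Lemma pf_norm_cst f a : bmf f -> (forall y, `|f y| <= a) -> `|L f| <= a.
Proof.
move=> bf fa; rewrite -[leRHS]pf_cst; apply: (sl_norm sL) => //.
- exact: (pf_ge0 pL).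
- exact: bmf_cst.
Qed.

Lemma pf_sqrB f a : bmf f ->
  L ((f - cst a) * (f - cst a)) = L (f * f) - 2 * a * L f + a ^+ 2.
Proof.
move=> bf; have -> : (f - cst a) * (f - cst a) =
    (- 2 * a) *: f + (f * f + cst (a ^+ 2)).
  by apply/funext => x; rewrite !fctE /GRing.scale/=; ring.
have bff : bmf (f * f) by exact: bmfM.
have bc : bmf (cst (a ^+ 2) : X -> R) by exact: bmf_cst.
rewrite (sl_lin sL)//; last exact: bmfD.
by rewrite (slD sL)// pf_cst; ring.
Qed.

Lemma pf_jensen f : bmf f -> L f ^+ 2 <= L (f * f).
Proof.
move=> bf; have : 0 <= L ((f - cst (L f)) * (f - cst (L f))).
  apply: (pf_ge0 pL) => [|x]; last by rewrite fctE -expr2 sqr_ge0.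
  by apply: bmfM; apply: bmfB => //; exact: bmf_cst.
by rewrite pf_sqrB//; lra.
Qed.

End functional.

(* If [nu <= kappa * pi], then [pi - nu / kappa] is again a positive measure,
   of mass [1 - 1 / kappa]; this yields the sharp constant without appealing to
   the density of [nu]. *)
Lemma dominated_centered_bound (pi nu : (X -> R) -> R) (kappa : R) f :
  prob_functional pi -> prob_functional nu ->
  (forall g, bmf g -> (forall x, 0 <= g x) -> nu g <= kappa * pi g) ->
  bmf f -> pi f = 0 -> `|nu f| <= Num.sqrt (kappa - 1) * Num.sqrt (pi (f * f)).
Proof.
move=> ppi pnu dom bf pf0.
have k1 : 1 <= kappa.
  have := dom _ (bmf_cst X (1 : R)) (fun=> ler01).
  by rewrite (pf1 ppi) (pf1 pnu) mulr1.
(* Domination is applied to $(f+a)^2$; Jensen's inequality replaces $\nu(f^2)$ by $\nu(f)^2$, and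
   $\pi(f)=0$ removes the cross term on the right. *)
have bound a : nu f ^+ 2 + 2 * a * nu f <= kappa * pi (f * f) + (kappa - 1) * a ^+ 2.
  have bg : bmf ((f - cst (- a)) * (f - cst (- a))).
    by apply: bmfM; apply: bmfB => //; exact: bmf_cst.
  have := dom _ bg; rewrite !pf_sqrB// pf0.
  have -> : (forall x, 0 <= ((f - cst (- a)) * (f - cst (- a))) x) = True.
    by apply/propext; split => // _ x; rewrite fctE -expr2 sqr_ge0.
  move=> /(_ I); have := pf_jensen pnu bf; rewrite sqrrN; lra.
have pff : 0 <= pi (f * f).
  by apply: (pf_ge0 ppi) => [|x]; [exact: bmfM|rewrite fctE -expr2 sqr_ge0].
rewrite -sqrtrM ?subr_ge0// -sqrtr_sqr ler_sqrt; last first.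
  by rewrite mulr_ge0// subr_ge0.
move: k1; rewrite le_eqVlt => /orP[/eqP k1|k1].
  rewrite -k1 subrr mul0r.
  have [->|nf0] := eqVneq (nu f) 0; first by rewrite expr0n.
  (* For [kappa = 1] the right side of [bound] does not depend on [a], which forces [nu f = 0]. *)
  have := bound ((pi (f * f) + 1) / (2 * nu f)).
  rewrite -k1 subrr mul0r mul1r addr0.
  have -> : 2 * ((pi (f * f) + 1) / (2 * nu f)) * nu f = pi (f * f) + 1.
    by field.
  have := sqr_ge0 (nu f); lra.
have k0 : 0 < kappa - 1 by rewrite subr_gt0.
(* This is the optimal [a]: it maximizes $2a\,\nu(f)-(\kappa-1)a^2$. *)
have := bound (nu f / (kappa - 1)).
have -> : nu f ^+ 2 + 2 * (nu f / (kappa - 1)) * nu f =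
  nu f ^+ 2 * ((kappa + 1) / (kappa - 1)) by field; rewrite gt_eqF.
have -> : (kappa - 1) * (nu f / (kappa - 1)) ^+ 2 = nu f ^+ 2 / (kappa - 1).
  by field; rewrite gt_eqF.
rewrite -lerBlDr.
have -> : nu f ^+ 2 * ((kappa + 1) / (kappa - 1)) - nu f ^+ 2 / (kappa - 1) =
  kappa * (nu f ^+ 2 / (kappa - 1)) by field; rewrite gt_eqF.
by rewrite ler_pM2l ?(lt_trans ltr01)// ler_pdivrMr// mulrC.
Qed.

End kernel_operators.

(** * Drift functions and Neumann series *)

Lemma bmf_sum d (X : measurableType d) (R : realType) (u : nat -> X -> R) n :
  (forall i, bmf (u i)) -> bmf (\sum_(i < n) u i).
Proof.
move=> bu; elim: n => [|n IH]; first by rewrite big_ord0; exact: bmf_cst.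
by rewrite big_ord_recr; exact: bmfD.
Qed.

Section drift.
Context d (X : measurableType d) (R : realType).
Variables (Q : (X -> R) -> X -> R) (V : X -> R) (lam h : R).
Hypotheses (kQ : kernel_op Q) (bV : bmf V) (lam_gt1 : 1 < lam).
Hypotheses (V_ge1 : forall x, 1 <= V x) (V_le : forall x, V x <= h).
Hypothesis QV : forall x, Q V x <= lam^-1 * V x.

Let l0 : 0 < lam. Proof. exact: lt_trans lam_gt1. Qed.

Lemma iter_drift_bound f c n x : bmf f -> (forall y, `|f y| <= c) ->
  `|iter n Q f x| <= c * lam^-1 ^+ n * V x.
Proof.
move=> bf fc; have c0 : 0 <= c by rewrite (le_trans _ (fc x)).
elim: n x => [|n IH] x /=.
  by rewrite mulr1 (le_trans (fc x))// ler_peMr.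
have -> : c * lam^-1 ^+ n.+1 * V x = (c * lam^-1 ^+ n) * (lam^-1 * V x).
  by rewrite exprSr; ring.
have cn0 : 0 <= c * lam^-1 ^+ n by rewrite mulr_ge0// exprn_ge0// invr_ge0 ltW.
rewrite (le_trans _ (ler_wpM2l cn0 (QV x)))//.
rewrite -(slZ (ko_sl kQ x))//; apply: (ko_norm kQ) => //.
- exact: ko_iter.
- exact: bmfZ.
Qed.

(** The drift inequality bounds the n-th term of $\sum_n z^nQ^nf$ by $ch(z/\lambda)^n$. The sum is a
    bounded pointwise limit, along which [Q] is continuous. *)
Lemma neumann z f c : 0 <= z -> z < lam -> bmf f -> (forall y, `|f y| <= c) ->
  exists r, [/\ bmf r, r - z *: Q r = f,
    (forall x, `|r x| <= c * h / (1 - z / lam)) &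
    (forall x, 0 <= f x) -> forall x, 0 <= r x].
Proof.
move=> z0 zl bf fc.
pose u n := z ^+ n *: iter n Q f.
pose s n := \sum_(i < n) u i.
have bi n : bmf (iter n Q f) by exact: ko_iter.
have bu n : bmf (u n) by exact: bmfZ.
have bs n : bmf (s n) by exact: bmf_sum.
have uS n : z *: Q (u n) = u n.+1.
  apply/funext => x; change (z * Q (u n) x = z ^+ n.+1 * Q (iter n Q f) x).
  by rewrite (slZ (ko_sl kQ x))// mulrA -exprS.
(* The partial sums in fixed-point form; the limit of this recursion is the resolvent equation. *)
have sS n : f + z *: Q (s n) = s n.+1.
  elim: n => [|n IH].
    rewrite /s big_ord_recl !big_ord0 addr0 /u expr0 scale1r /=.
    have -> : Q 0 = 0 by apply/funext => x; exact: (sl0 (ko_sl kQ x)).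
    by rewrite scaler0 addr0.
  rewrite /s big_ord_recr/= -[X in Q (X + _)]scale1r (ko_lin kQ)//; last exact: bmf_sum.
  by rewrite scale1r scalerDr addrA IH uS [RHS]big_ord_recr.
pose q := z / lam.
have q0 : 0 <= q by rewrite divr_ge0// ltW.
have q1 : q < 1 by rewrite ltr_pdivrMr// mul1r.
have h1 (x : X) : 1 <= h by exact: le_trans (V_ge1 x) (V_le x).
have u_le : forall n x, `|u n x| <= c * h * q ^+ n.
  move=> n x.
  have c0 : 0 <= c by rewrite (le_trans _ (fc x)).
  change (`|z ^+ n * iter n Q f x| <= c * h * q ^+ n).
  rewrite normrM ger0_norm ?exprn_ge0//.
  rewrite (le_trans (ler_wpM2l _ (iter_drift_bound n x bf fc))) ?exprn_ge0//.
  rewrite /q expr_div_n -exprVn.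
  have -> : z ^+ n * (c * lam^-1 ^+ n * V x) = c * (z ^+ n * lam^-1 ^+ n) * V x.
    by ring.
  rewrite -mulrA (mulrC _ (V x)) -[leRHS]mulrA ler_wpM2l// ler_wpM2r//.
  by rewrite mulr_ge0// exprn_ge0// invr_ge0 ltW.
have sE n x : s n x = series (u ^~ x) n by rewrite /s fct_sumE /series/= big_mkord.
have sb n x : `|s n x| <= c * h / (1 - q).
  have c0 : 0 <= c by rewrite (le_trans _ (fc x)).
  rewrite sE /series/= (le_trans (ler_norm_sum _ _ _))//.
  rewrite (@le_trans _ _ (\sum_(0 <= i < n) geometric (c * h) q i))//.
    by apply: ler_sum => i _; exact: u_le.
  have -> : \sum_(0 <= i < n) geometric (c * h) q i =
      series (geometric (c * h) q) n by [].
  rewrite geometric_seriesE ?lt_eqF// ler_wpM2r//.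
    by rewrite invr_ge0 subr_ge0 ltW.
  by rewrite ler_piMr ?mulr_ge0 ?(le_trans ler01 (h1 x))// gerBl exprn_ge0.
have sc x : cvgn (s ^~ x).
  have -> : s ^~ x = series (u ^~ x) by apply/funext => n; exact: sE.
  apply: normed_cvg.
  apply: (@series_le_cvg _ _ (geometric (c * h) q)) => [n||n|].
  - exact: normr_ge0.
  - rewrite /geometric/=; have c0 : 0 <= c by rewrite (le_trans _ (fc x)).
    by move=> n; rewrite !mulr_ge0 ?exprn_ge0 ?(le_trans ler01 (h1 x)).
  - exact: u_le.
  - by apply: is_cvg_geometric_series; rewrite ger0_norm.
pose r x := limn (s ^~ x).
have sr : bounded_cvg s r.
  split=> [n||x]; first by have [] := bs n.
  - by exists (c * h / (1 - q)).
  - exact: sc.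
have br := bounded_cvg_bmf sr.
exists r; split => //.
- apply/funext => x; apply/eqP.
  rewrite [(r - _) x]/GRing.add/= subr_eq addrC eq_sym; apply/eqP.
  have [_ _ cv] := sr.
  have /= c1 := cv x; rewrite -(cvg_shiftS (s ^~ x)) in c1.
  apply: (cvg_unique _ _ c1) => //.
  rewrite (_ : (fun n => s n.+1 x) = fun n => z * Q (s n) x + f x).
    apply: cvgD; last exact: cvg_cst.
    by apply: cvgM; [exact: cvg_cst|exact: (sl_cvg (ko_sl kQ x) sr)].
  by apply/funext => n; rewrite -sS addrC.
- move=> x; have clc : closed (fun y : R => `|y| <= c * h / (1 - q)).
    apply: (@closed_comp _ _ (fun y : R => `|y|) [set y : R | y <= c * h / (1 - q)]).
      by move=> y _; exact: norm_continuous.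
    exact: closed_le.
  by apply: (closed_cvg _ clc _ _ (sc x)); exact: nearW.
- move=> f0 x; have cl0 : closed (fun y : R => 0 <= y) by exact: closed_ge.
  have s0 n y : 0 <= s n y.
    elim: n y => [|n IH] y; first by rewrite /s big_ord0.
    rewrite -sS [_ y]/GRing.add/= addr_ge0// mulr_ge0//.
    exact: (ko_ge0 kQ).
  by apply: (closed_cvg _ cl0 _ _ (sc x)); exact: nearW.
Qed.

End drift.

(** * Tail sums of the hitting time *)

Section hitting_moment.
Context d (X : measurableType d) (R : realType).
Variables (P : (X -> R) -> X -> R) (A : set X) (M : R).
Hypotheses (kP : kernel_op P) (mA : measurable A).

(* [P_x(sigma_A > n)] *)
Definition survival n : X -> R :=
  iter n (fun f => \1_(~` A) * P f) \1_(~` A).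

Lemma survivalS n x : survival n.+1 x = \1_(~` A) x * P (survival n) x.
Proof. by []. Qed.

Let bC : bmf (\1_(~` A) : X -> R).
Proof. by apply: bmf_indic; exact: measurableC. Qed.

Lemma survival_bmf n : bmf (survival n).
Proof.
elim: n => [//|n IH]; apply: bmfM => //; exact: (ko_bmf kP).
Qed.

Lemma survival_ge0 n x : 0 <= survival n x.
Proof.
elim: n x => [x|n IH x]; first by rewrite /survival [X in 0 <= X]indicE.
rewrite mulr_ge0//.
by apply: (ko_ge0 kP) => //; exact: survival_bmf.
Qed.

Hypothesis survival_sum : forall n x, \sum_(i < n) survival i x <= M.

(** [U] is $\sum_{n\ge 0}\mathbb{P}_x(\sigma_A>n)=\mathbb{E}_x[\sigma_A]$, and its equation is
    first-step analysis, the limit of the same recursion for the partial sums. *)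
Lemma mean_hitting_time : exists U : X -> R, [/\ bmf U,
  forall x, 0 <= U x <= M & forall x, U x = \1_(~` A) x * (1 + P U x)].
Proof.
pose s n := \sum_(i < n) survival i.
have sE n x : s n x = \sum_(i < n) survival i x by rewrite /s fct_sumE.
have bs n : bmf (s n) by apply: bmf_sum => i; exact: survival_bmf.
have s0 n x : 0 <= s n x by rewrite sE; apply: sumr_ge0 => i _; exact: survival_ge0.
have sM n x : s n x <= M by rewrite sE.
have snd x : nondecreasing_seq (s ^~ x).
  apply/nondecreasing_seqP => n; rewrite !sE big_ord_recr/= lerDl.
  exact: survival_ge0.
have sS n : \1_(~` A) * (cst 1 + P (s n)) = s n.+1.
  elim: n => [|n IH].
    rewrite /s big_ord_recl !big_ord0 addr0.
    have -> : P 0 = 0 by apply/funext => x; exact: (sl0 (ko_sl kP x)).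
    by rewrite addr0; apply/funext => x; exact: mulr1.
  rewrite /s big_ord_recr/= -[X in P (X + _)]scale1r (ko_lin kP)//; last 2 first.
  - by apply: bmf_sum => i; exact: survival_bmf.
  - exact: survival_bmf.
  by rewrite scale1r addrA mulrDr IH [RHS]big_ord_recr.
have sc x : cvgn (s ^~ x).
  by apply: nondecreasing_is_cvgn => //; exists M => _ [n _ <-].
pose U x := limn (s ^~ x).
have sU : bounded_cvg s U.
  split=> [n||x]; first by have [] := bs n.
  - by exists M => n x; rewrite ger0_norm.
  - exact: sc.
exists U; split => [|x|x]; first exact: bounded_cvg_bmf sU.
- apply/andP; split.
    by apply: limr_ge => //; exact: nearW.
  by apply: limr_le => //; exact: nearW.
- have [_ _ cv] := sU.
  have /= c1 := cv x; rewrite -(cvg_shiftS (s ^~ x)) in c1.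
  apply/esym; apply: (cvg_unique _ _ c1) => //.
  rewrite (_ : (fun n => s n.+1 x) = fun n => \1_(~` A) x * (1 + P (s n) x)).
    apply: cvgM; first exact: cvg_cst.
    by apply: cvgD; [exact: cvg_cst|exact: (sl_cvg (ko_sl kP x) sU)].
  by apply/funext => n; rewrite -sS.
Qed.

End hitting_moment.

(** * Regeneration *)

Section regeneration.
Context d (X : measurableType d) (R : realType).
Variables (P : (X -> R) -> X -> R) (pi nu : (X -> R) -> R) (A : set X).
Variables (delta M lam : R).
Hypotheses (kP : kernel_op P) (P1 : P (cst 1) = cst 1) (mA : measurable A).
Hypotheses (ppi : prob_functional pi) (pnu : prob_functional nu).
Hypotheses (delta_gt0 : 0 < delta) (piA_gt0 : 0 < pi \1_A) (lam_gt1 : 1 < lam).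
Hypothesis minor : forall f x, bmf f -> (forall y, 0 <= f y) ->
  delta * \1_A x * nu f <= P f x.
Hypothesis inv : forall f, bmf f -> pi (P f) = pi f.
Hypothesis sym : forall f g, bmf f -> bmf g -> pi (P f * g) = pi (f * P g).
Hypothesis pos : forall f, bmf f -> 0 <= pi (f * P f).
Hypothesis survival_sum : forall n x, \sum_(i < n) survival P A i x <= M.
Hypothesis lam_lt : lam < (1 + delta * lam) * (1 - M * ln lam).

Let l0 : 0 < lam. Proof. exact: lt_trans lam_gt1. Qed.

Let bA : bmf (\1_A : X -> R). Proof. exact: bmf_indic. Qed.

Let A_inhabited : exists x, A x.
Proof.
apply/set0P/eqP => A0; move: piA_gt0.
by rewrite A0 indic0 (_ : pi _ = 0) ?ltxx//; exact: (sl0 (pf_sl ppi)).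
Qed.

Let M_ge0 : 0 <= M.
Proof.
by have [x _] := A_inhabited; have := survival_sum 0 x; rewrite big_ord0.
Qed.

Let delta_le1 : delta <= 1.
Proof.
have [x Ax] := A_inhabited.
have := minor x (bmf_cst X (1 : R)) (fun=> ler01).
by rewrite P1 (pf1 pnu) indicE mem_set// !mulr1.
Qed.

(* Governs the split chain strictly before its first regeneration. *)
Definition residual (f : X -> R) : X -> R := P f - (delta * nu f) *: \1_A.

Lemma residualE f x : residual f x = P f x - delta * \1_A x * nu f.
Proof. by rewrite /residual !fctE /GRing.scale/=; ring. Qed.

Lemma residual_kernel_op : kernel_op residual.
Proof.
split=> [f bf|x|f bf f0 x|x].
- by apply: bmfB; [exact: (ko_bmf kP)|exact: bmfZ].
- rewrite (_ : residual ^~ x = fun f => (- (delta * \1_A x)) * nu f + P f x).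
    by apply: sigma_linear_lin; [exact: pf_sl|exact: (ko_sl kP)].
  by apply/funext => f; rewrite residualE; ring.
- by rewrite residualE subr_ge0; exact: minor.
- rewrite residualE P1 (pf1 pnu) mulr1 gerBl mulr_ge0 ?(ltW delta_gt0)//.
Qed.

(** [1 - theta] is the drift factor to be reached; [h] solves [h = 1 + theta * h * M], so that
    [1 + theta * h * U] is at most [h] whenever [U <= M]. *)
Let theta := 1 - lam^-1.
Let h := (1 - theta * M)^-1.

Let theta_gt0 : 0 < theta.
Proof. by rewrite subr_gt0 invf_lt1. Qed.

Let theta_ln : theta <= ln lam.
Proof.
have := @le_ln1Dx R (lam^-1 - 1).
rewrite ltrBrDr addrC subrr invr_gt0 l0 => /(_ isT).
by rewrite addrC subrK lnV ?posrE// /theta lerNl opprB.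
Qed.

Let ml := 1 - M * ln lam.

Let ml_gt0 : 0 < ml.
Proof.
have : 0 < (1 + delta * lam) * ml by exact: lt_trans lam_lt.
by rewrite pmulr_rgt0// addr_gt0// mulr_gt0.
Qed.

Let ml_le : ml <= 1 - theta * M.
Proof. by rewrite lerB// mulrC ler_wpM2l. Qed.

Let h_gt0 : 0 < h.
Proof. by rewrite invr_gt0 (lt_le_trans ml_gt0). Qed.

Let h_fix : h = 1 + theta * h * M.
Proof.
have : h * (1 - theta * M) = 1 by rewrite mulVf// gt_eqF// (lt_le_trans ml_gt0).
by rewrite mulrBr mulr1 => <-; ring.
Qed.

Let h_mlV : h <= ml^-1.
Proof. by rewrite lef_pV2 ?posrE// (lt_le_trans ml_gt0). Qed.

(** On [A] the drift function equals 1 and the residual mass is [1 - delta], so bounding the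
    function by [h] there calls for [(1 - delta) * h <= lam^-1]. Since [ml <= 1], [lam_lt] gives
    [lam * (1 - delta) < ml]. *)
Let h_residual : lam * (1 - delta) * h <= 1.
Proof.
have [d1|d1] := leP 1 delta.
  rewrite (@le_trans _ _ 0)// mulr_le0_ge0 ?(ltW h_gt0)//.
  by rewrite mulr_ge0_le0 ?(ltW l0)// subr_le0.
have a0 : 0 <= lam * (1 - delta) by rewrite mulr_ge0 ?(ltW l0)// subr_ge0 ltW.
rewrite (le_trans (ler_wpM2l a0 h_mlV))// ler_pdivrMr// mul1r.
have : ml * (delta * lam) <= 1 * (delta * lam).
  rewrite ler_wpM2r ?mulr_ge0 ?(ltW l0) ?(ltW delta_gt0)//.
  by rewrite gerBl mulr_ge0// (le_trans (ltW theta_gt0)).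
have := lam_lt; rewrite -/ml; lra.
Qed.

Let M2' := M2 delta M lam.

(** After replacing [h] by [ml^-1] and clearing denominators this reads
    [ml * (1 + delta * (lam - 1)) <= lam], true because [ml] and [delta] are at most 1. *)
Let h_M2 : h <= lam^-1 * M2'.
Proof.
have den0 : 0 < (1 + delta * lam) * ml - lam by rewrite subr_gt0.
rewrite (le_trans h_mlV)// /M2' /M2 -/ml mulrA mulrCA mulVf ?gt_eqF// mulr1.
rewrite ler_pdivlMr// mulrC ler_pdivrMr//.
have : ml * (delta * (lam - 1)) <= delta * (lam - 1).
  rewrite -[leRHS]mul1r ler_wpM2r//.
    by rewrite mulr_ge0 ?(ltW delta_gt0)// subr_ge0 ltW.
  by rewrite gerBl mulr_ge0// (le_trans (ltW theta_gt0)).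
have : ml <= 1 by rewrite gerBl mulr_ge0// (le_trans (ltW theta_gt0)).
have : delta * (lam - 1) <= 1 * (lam - 1).
  by rewrite ler_wpM2r// subr_ge0 ltW.
lra.
Qed.

(* [1 + theta h U], with [U] the mean hitting time of [A], is an affine
   surrogate for [E_x lam^{sigma_A}]: off [A], [P U = U - 1] and the drift
   inequality reduces to [V <= h]. *)
Lemma drift_function : exists V : X -> R, [/\ bmf V, forall x, 1 <= V x,
  forall x, V x <= h & forall x, residual V x <= lam^-1 * V x].
Proof.
have [U [bU U0 UE]] := mean_hitting_time kP mA survival_sum.
pose V := (theta * h) *: U + cst 1.
have VE x : V x = theta * h * U x + 1 by [].
have th0 : 0 <= theta * h by rewrite mulr_ge0 ?(ltW h_gt0)// ltW.
have b1 : bmf (cst 1 : X -> R) by exact: bmf_cst.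
have bV : bmf V by exact: bmf_lin.
have Vh x : V x <= h.
  rewrite VE addrC [leRHS]h_fix lerD2l ler_wpM2l//; by have /andP[] := U0 x.
exists V; split => // x.
  by rewrite VE lerDr mulr_ge0//; have /andP[] := U0 x.
have kQ := residual_kernel_op.
have [Ax|Ax] := boolP (x \in A).
  have -> : V x = 1.
    by rewrite VE UE indicE in_setC Ax mul0r mulr0 add0r.
  have : residual V x <= residual (cst h) x.
    by apply: (ko_le kQ) => //; exact: bmf_cst.
  have -> : residual (cst h) x = (1 - delta) * h.
    rewrite residualE (pf_cst pnu) indicE Ax mulr1.
    have -> : cst h = h *: cst 1 :> (X -> R) by apply/funext => y; exact/esym/mulr1.
    by rewrite (slZ (ko_sl kP x))// P1/=; ring.
  move=> /le_trans; apply.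
  by rewrite mulr1 -(ler_pM2l l0) mulfV ?gt_eqF// mulrA.
rewrite residualE indicE (negbTE Ax) mulr0 mul0r subr0.
rewrite {1}/V (sl_lin (ko_sl kP x))// P1.
have -> : P U x = U x - 1.
  by have := UE x; rewrite indicE in_setC Ax mul1r => ->; rewrite addrC addKr.
have := Vh x.
have -> : theta * h * (U x - 1) + cst 1 x = V x - theta * h by rewrite VE /=; ring.
rewrite -(ler_pM2l theta_gt0).
have -> : lam^-1 = 1 - theta by rewrite /theta; ring.
lra.
Qed.

Let D (f : X -> R) := bmf f /\ pi f = 0.
Let ip (f g : X -> R) := pi (f * g).

Let D_lin : lin_closed D.
Proof.
move=> a f g [bf f0] [bg g0]; split; first exact: bmf_lin.
by rewrite (sl_lin (pf_sl ppi))// f0 g0 mulr0 addr0.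
Qed.

Let ip_psd : psd_form D ip.
Proof.
split=> [a f g k [bf _] [bg _] [bk _]|f g _ _|f [bf _]].
- rewrite /ip -(sl_lin (pf_sl ppi)); [|exact: bmfM..].
  by congr pi; apply/funext => x; rewrite !fctE /GRing.scale/=; ring.
- by rewrite /ip mulrC.
- by apply: (pf_ge0 ppi) => [|x]; [exact: bmfM|rewrite fctE -expr2 sqr_ge0].
Qed.

(* Solutions of [g - z P g = f] come from the Neumann series of the residual
   kernel and a rank-one correction; for [z > 1] the correction is determined
   because [k = \sum_n z^n Q^n 1 >= 1], and for [z = 1] it vanishes. *)
Lemma poisson_equation z : 1 <= z -> z < lam -> exists2 C, 0 < C &
  forall f c, D f -> (forall x, `|f x| <= c) ->
  exists g, [/\ D g, g - z *: P g = f & forall x, `|g x| <= C * c].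
Proof.
move=> z1 zl.
have [V [bV V1 Vh QV]] := drift_function.
have kQ := residual_kernel_op.
have z0 : 0 < z by exact: lt_le_trans z1.
have solve := neumann kQ bV lam_gt1 V1 Vh QV (ltW z0) zl.
pose K := h / (1 - z / lam).
have K0 : 0 < K by rewrite divr_gt0// subr_gt0 ltr_pdivrMr// mul1r.
have [k [bk kE kK k1]] : exists k, [/\ bmf k, k - z *: residual k = cst 1,
    forall x, `|k x| <= K & forall x, 1 <= k x].
  have [y|k [bk kE kK k0]] := solve (cst 1) 1 (bmf_cst X (1 : R)).
    by rewrite normr1.
  exists k; split => // [x|x]; first by rewrite /K -[h]mul1r.
  have /(congr1 (fun f => f x)) := kE.
  rewrite !fctE => /eqP; rewrite subr_eq => /eqP ->; rewrite lerDl.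
  rewrite mulr_ge0 ?(ltW z0)// (ko_ge0 kQ)//.
  by apply: k0 => y.
have [x0 Ax0] := A_inhabited.
move: z1; rewrite le_eqVlt => /orP[/eqP z1|z1].
  exists (2 * K) => [|f c [bf f0] fc]; first by rewrite mulr_gt0.
  have [r [br rE rK _]] := solve _ _ bf fc.
  (* Applying [pi] to the resolvent equation at [z = 1] cancels [pi r] against [pi (P r)] and leaves
     [delta * pi(A) * nu r = 0]. *)
  have nur : nu r = 0.
    have /(congr1 pi) := rE.
    rewrite f0 -z1 scale1r (slB (pf_sl ppi))//; last exact: (ko_bmf kQ).
    rewrite /residual (slB (pf_sl ppi)); [|exact: (ko_bmf kP)|exact: bmfZ].
    rewrite inv// opprB addrCA subrr addr0 (slZ (pf_sl ppi))// => /eqP.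
    by rewrite !mulf_eq0 (gt_eqF piA_gt0) (gt_eqF delta_gt0) orbF => /eqP.
  have rP : residual r = P r.
    by apply/funext => x; rewrite residualE nur mulr0 subr0.
  exists (r - cst (pi r)); split.
  - split; first by apply: bmfB => //; exact: bmf_cst.
    by rewrite (slB (pf_sl ppi)) ?(pf_cst ppi) ?subrr//; exact: bmf_cst.
  - have -> : P (r - cst (pi r)) = P r - cst (pi r).
      apply/funext => x; rewrite (slB (ko_sl kP x))//; last exact: bmf_cst.
      have -> : cst (pi r) = pi r *: cst 1 :> (X -> R).
        by apply/funext => y; exact/esym/mulr1.
      rewrite (slZ (ko_sl kP x)) ?P1//; exact: bmf_cst.
    rewrite -z1 scale1r -rE -z1 scale1r rP.
    by apply/funext => x; rewrite !fctE; ring.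
  - have pr : `|pi r| <= K * c.
      by apply: (pf_norm_cst ppi) => // x; rewrite (le_trans (rK x))// /K; lra.
    move=> x; rewrite !fctE (le_trans (ler_normB _ _))//.
    have := rK x; rewrite (_ : c * h / (1 - z / lam) = K * c); last by rewrite /K; ring.
    lra.
have nuk : 1 <= nu k.
  by rewrite -[leLHS](pf1 pnu); apply: (pf_le pnu) => //; exact: bmf_cst.
have zz0 : 0 < z - 1 by rewrite subr_gt0.
pose C := K + K / (z - 1) * (1 + (z - 1) * K).
have zK0 : 0 <= (z - 1) * K by rewrite ltW// mulr_gt0.
have Kz0 : 0 < K / (z - 1) by rewrite divr_gt0.
have C0 : 0 < C by rewrite addr_gt0// pmulr_rgt0// ltr_pwDl.
exists C => // f c [bf f0] fc.
have c0 : 0 <= c by rewrite (le_trans _ (fc x0)).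
have [r [br rE rK _]] := solve _ _ bf fc.
have {}rK x : `|r x| <= K * c.
  by rewrite (le_trans (rK x))// /K le_eqVlt; apply/orP; left; apply/eqP; ring.
(* In terms of the residual kernel $Q$ the equation is $g-zQg=f+z\delta 1_A\,\nu(g)$. Since
   $w=(z-1)k+1$ solves $w-zQw=z\delta 1_A$, the solution is $g=r+ew$ with $e=\nu(g)$; consistency,
   $e=\nu(r)+e\,\nu(w)$, determines [e]. *)
pose e := - nu r / ((z - 1) * nu k).
pose w := (z - 1) *: k + cst 1.
have b1 : bmf (cst 1 : X -> R) by exact: bmf_cst.
have bw : bmf w by exact: bmf_lin.
pose g := e *: w + r.
have bg : bmf g by exact: bmf_lin.
have nuk0 : nu k != 0 by rewrite gt_eqF// (lt_le_trans ltr01).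
have nug : nu g = e.
  rewrite /g /w !(sl_lin (pf_sl pnu))// (pf1 pnu) /e; field.
  by rewrite nuk0 gt_eqF.
have gE : g - z *: P g = f.
  apply/funext => x.
  have rx : r x = f x + z * residual r x by rewrite -rE !fctE /GRing.scale/=; ring.
  have kx : k x = 1 + z * residual k x.
    by have /(congr1 (fun f => f x))/= <- := kE; rewrite !fctE /GRing.scale/=; ring.
  have Q1 : residual (cst 1) x = 1 - delta * \1_A x.
    by rewrite residualE P1 (pf1 pnu) mulr1.
  have Pg : P g x = e * ((z - 1) * residual k x + (1 - delta * \1_A x)) +
      residual r x + delta * \1_A x * e.
    have -> : P g x = residual g x + delta * \1_A x * e.
      by rewrite residualE nug subrK.
    by rewrite /g (ko_lin kQ)// /w (ko_lin kQ)// !fctE Q1.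
  rewrite !fctE Pg /g /w !fctE rx kx /GRing.scale/=; ring.
have gC x : `|g x| <= C * c.
  rewrite /g !fctE (le_trans (ler_normD _ _))// /C mulrDl addrC lerD//.
  have -> : K / (z - 1) * (1 + (z - 1) * K) * c =
      (K * c / (z - 1)) * (1 + (z - 1) * K) by ring.
  rewrite /GRing.scale/= normrM ler_pM//.
    rewrite /e normrM normrN normfV ler_pM ?invr_ge0//.
      exact: (pf_norm_cst pnu).
    rewrite lef_pV2 ?posrE ?normr_gt0 ?mulf_neq0 ?(gt_eqF zz0)//.
    by rewrite ger0_norm ?mulr_ge0 ?(ltW zz0) ?(le_trans ler01 nuk)// ler_peMr// ltW.
  rewrite /w !fctE addrC (le_trans (ler_normD _ _))// normr1 lerD2l normrM.
  by rewrite gtr0_norm// ler_wpM2l// ltW.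
exists g; split => //; split => //.
(* Centering is automatic for [z > 1]: applying [pi] gives [(1 - z) * pi g = 0]. *)
have := congr1 pi gE; rewrite f0 (slB (pf_sl ppi))//; last first.
  by apply: bmfZ; exact: (ko_bmf kP).
rewrite (slZ (pf_sl ppi)) ?inv//; last exact: (ko_bmf kP).
rewrite -[X in X - _]mul1r -mulrBl => /eqP; rewrite mulf_eq0 => /orP[|/eqP//].
by rewrite subr_eq0 eq_sym gt_eqF.
Qed.

Let P_D f : D f -> D (P f).
Proof. by move=> [bf f0]; split; [exact: (ko_bmf kP)|rewrite inv]. Qed.

Let pi_sqr_P f : bmf f -> pi (P f * P f) <= pi (f * f).
Proof.
move=> bf; rewrite -(inv (bmfM bf bf)).
apply: (pf_le ppi) => [| |x].
- by apply: bmfM; exact: (ko_bmf kP).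
- by apply: (ko_bmf kP); exact: bmfM.
have pPx : prob_functional (fun g => P g x).
  split; first exact: (ko_sl kP).
    by move=> g bg g0; exact: (ko_ge0 kP).
  by rewrite P1.
exact: (pf_jensen pPx bf).
Qed.

Let supn (f : X -> R) := sup (range (fun x => `|f x|)).

Lemma l2_contraction f n : bmf f -> pi f = 0 ->
  pi (iter n P f * iter n P f) <= (lam^-1 ^+ n) ^+ 2 * pi (f * f).
Proof.
move=> bf f0; have [x0 _] := A_inhabited.
have supn_le g x : bmf g -> `|g x| <= supn g.
  move=> [_ [c gc]]; apply: ub_le_sup; last by exists x.
  by exists c => _ [y _ <-].
have ip_le g : D g -> ip g g <= supn g ^+ 2.
  move=> [bg _]; rewrite -(pf_cst ppi (supn g ^+ 2)); apply: (pf_le ppi) => [||x].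
  - exact: bmfM.
  - exact: bmf_cst.
  rewrite fctE -expr2 -real_normK ?num_real//.
  by rewrite ler_sqr ?nnegrE ?supn_le// (le_trans (normr_ge0 (g x0)))// supn_le.
(* For unbounded [g] the supremum takes the default value 0. *)
have supn_ge0 g : 0 <= supn g.
  have [hs|hs] := pselect (has_sup (range (fun x => `|g x|))).
    apply: (le_trans (normr_ge0 (g x0))).
    by apply: ub_le_sup; [exact: hs.2|exists x0].
  by rewrite /supn sup_out.
have solvable z : 1 <= z -> z < lam -> exists2 C, 0 < C &
    forall f, D f -> exists2 g, D g & g - z *: P g = f /\ supn g <= C * supn f.
  move=> z1 zl; have [C C0 sol] := poisson_equation z1 zl; exists C => // g Dg.
  have [k [Dk kE kC]] := sol g (supn g) Dg (fun x => supn_le g x Dg.1).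
  exists k => //; split => //; apply: ge_sup; first by exists `|k x0|, x0.
  by move=> _ [x _ <-].
have T_le1 g : D g -> ip g (P g) <= ip g g.
  move=> [bg g0].
  have bPg : bmf (P g) by exact: (ko_bmf kP).
  have b2 : bmf (g - P g) by exact: bmfB.
  have : 0 <= pi ((g - P g) * (g - P g)).
    by apply: (pf_ge0 ppi) => [|x]; [exact: bmfM|rewrite fctE -expr2 sqr_ge0].
  have -> : (g - P g) * (g - P g) = (- 2) *: (g * P g) + (g * g + P g * P g).
    by apply/funext => x; rewrite !fctE /GRing.scale/=; ring.
  rewrite (sl_lin (pf_sl ppi)); [|exact: bmfM|by apply: bmfD; exact: bmfM].
  rewrite (slD (pf_sl ppi)); [|exact: bmfM..].
  have := pi_sqr_P bg; rewrite /ip; lra.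
have step g : D g -> ip (P g) (P g) <= lam^-1 ^+ 2 * ip g g.
  apply: (@contraction _ _ D ip P supn lam) => //.
  - by move=> h1 h2 [b1 _] [b2 _]; exact: sym.
  - by move=> h1 [b1 _]; exact: pos.
elim: n => [|n IH]; first by rewrite expr1n mul1r.
have Dn : D (iter n P f).
  by elim: n {IH} => [|n IH] //=; exact: P_D.
rewrite (exprS lam^-1 n) exprMn -mulrA (le_trans (step _ Dn))// ler_wpM2l ?sqr_ge0//.
Qed.

Let kappa := (delta * pi \1_A)^-1.
Let c2 := C2 delta (pi \1_A).

Lemma regeneration_bound n f x : bmf f -> (forall y, `|f y| <= 1) ->
  `|iter n P f x - pi f| <=
    (D2 delta (pi \1_A) M lam + E2 delta (pi \1_A) M lam * n%:R) * lam ^- n.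
Proof.
move=> bf f1.
have [V [bV V1 Vh QV]] := drift_function.
have kQ := residual_kernel_op.
have bc a : bmf (cst a : X -> R) by exact: bmf_cst.
pose f0 := f - cst (pi f).
have bf0 : bmf f0 by exact: bmfB.
have pf0 : pi f0 = 0 by rewrite (slB (pf_sl ppi))// (pf_cst ppi) subrr.
have pif : `|pi f| <= 1 by exact: (pf_norm_cst ppi).
have f02 y : `|f0 y| <= 2.
  by rewrite /f0 !fctE (le_trans (ler_normB _ _))//; have := f1 y; lra.
have pff : pi (f0 * f0) <= 1.
  rewrite /f0 (pf_sqrB ppi)//.
  have : pi (f * f) <= 1.
    rewrite -(pf1 ppi); apply: (pf_le ppi) => // [|y]; first exact: bmfM.
    by rewrite fctE -expr2 -real_normK ?num_real// expr_le1.
  by have := sqr_ge0 (pi f); lra.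
have iterE m : iter m P f0 = iter m P f - cst (pi f).
  elim: m => [//|m IH]; rewrite /= IH; apply/funext => y.
  rewrite (slB (ko_sl kP y))//; last exact: ko_iter.
  have -> : cst (pi f) = pi f *: cst 1 :> (X -> R).
    by apply/funext => t; exact/esym/mulr1.
  by rewrite (slZ (ko_sl kP y)) ?P1.
(* The minorization integrated against [pi], with invariance on the right side; [c2] is the square
   root of [kappa - 1]. *)
have nu_dom g : bmf g -> (forall y, 0 <= g y) -> nu g <= kappa * pi g.
  move=> bg g0; rewrite /kappa ler_pdivlMl ?mulr_gt0//.
  rewrite -(inv bg) mulrAC -(slZ (pf_sl ppi))//.
  apply: (pf_le ppi) => [| |y]; [exact: bmfZ|exact: (ko_bmf kP)|].
  by have := minor y bg g0; rewrite mulrAC.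
have c20 : 0 <= c2 by exact: sqrtr_ge0.
have nu_iter m : `|nu (iter m P f0)| <= c2 * lam^-1 ^+ m.
  have bm : bmf (iter m P f0) by exact: ko_iter.
  have pm : pi (iter m P f0) = 0.
    by elim: m {bm} => [//|m IH] /=; rewrite inv//; exact: ko_iter.
  rewrite (le_trans (dominated_centered_bound ppi pnu nu_dom bm pm))//.
  rewrite ler_wpM2l//.
  have lm : 0 <= lam^-1 ^+ m by rewrite exprn_ge0// invr_ge0 ltW.
  rewrite -(@ger0_norm _ (lam^-1 ^+ m))// -sqrtr_sqr ler_sqrt ?sqr_ge0//.
  rewrite (le_trans (l2_contraction m bf0 pf0))//.
  by rewrite -[leRHS]mulr1 ler_wpM2l// sqr_ge0.
pose c2' := Num.max (2 - c2) 0.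
have c2'0 : 0 <= c2' by rewrite /c2' le_max lexx orbT.
(* At [m = 0] one needs [2 <= c2 + c2' * V], hence the choice of [c2']. In the induction step the
   residual image of the constant and the regeneration term add up to [c2 * lam^-1 ^+ m], which
   exceeds the constant part of [G m.+1] by [c2 * (lam - 1) * lam^-1 ^+ m.+1]. As [1 <= V], this
   excess is charged to [V] and makes its coefficient grow linearly in [m]. *)
pose G m : X -> R := lam^-1 ^+ m *: (cst c2 + (c2' + c2 * (lam - 1) * m%:R) *: V).
have bG m : bmf (G m) by apply: bmfZ; apply: bmfD => //; exact: bmfZ.
have bound m y : `|iter m P f0 y| <= G m y.
  elim: m y => [|m IH] y.
    rewrite (le_trans (f02 y))// /G expr0 mulr0 addr0 scale1r !fctE /GRing.scale/=.
    have : c2' <= c2' * V y by rewrite ler_peMr.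
    have : 2 - c2 <= c2' by rewrite /c2' le_max lexx.
    lra.
  have bg : bmf (iter m P f0) by exact: ko_iter.
  set K := c2' + c2 * (lam - 1) * m%:R.
  have lm1 : 0 <= lam - 1 by rewrite subr_ge0 ltW.
  have K0 : 0 <= K by rewrite addr_ge0// !mulr_ge0.
  set lm := lam^-1 ^+ m; have lm0 : 0 <= lm by rewrite exprn_ge0// invr_ge0 ltW.
  set a := delta * \1_A y.
  have a0 : 0 <= a by rewrite mulr_ge0// ltW.
  have Pg : iter m.+1 P f0 y = residual (iter m P f0) y + a * nu (iter m P f0).
    by rewrite residualE subrK.
  have Qg : `|residual (iter m P f0) y| <= lm * (c2 * (1 - a) + K * (lam^-1 * V y)).
    rewrite (le_trans (ko_norm kQ y bg (bG m) IH))//.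
    rewrite /G (slZ (ko_sl kQ y)); last by apply: bmfD => //; exact: bmfZ.
    rewrite -/lm -/K ler_wpM2l// (slD (ko_sl kQ y))//; last exact: bmfZ.
    rewrite (slZ (ko_sl kQ y))// lerD//; last by rewrite ler_wpM2l.
    have -> : cst c2 = c2 *: cst 1 :> (X -> R).
      by apply/funext => t; exact/esym/mulr1.
    by rewrite (slZ (ko_sl kQ y))// residualE P1 (pf1 pnu) mulr1.
  rewrite Pg (le_trans (ler_normD _ _))// normrM (ger0_norm a0).
  rewrite (le_trans (lerD Qg (ler_wpM2l a0 (nu_iter m))))// -/lm.
  have -> : G m.+1 y = lm * lam^-1 * (c2 + (K + c2 * (lam - 1)) * V y).
    rewrite /G !fctE /GRing.scale/= exprSr /lm /K -natr1; ring.
  rewrite -subr_ge0.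
  have -> : lm * lam^-1 * (c2 + (K + c2 * (lam - 1)) * V y) -
     (lm * (c2 * (1 - a) + K * (lam^-1 * V y)) + a * (c2 * lm)) =
     lm * lam^-1 * c2 * (lam - 1) * (V y - 1).
    by field; rewrite gt_eqF.
  by rewrite !mulr_ge0// ?invr_ge0 ?subr_ge0// ltW.
rewrite -[iter n P f x - pi f]/((iter n P f - cst (pi f)) x) -iterE.
rewrite (le_trans (bound n x))// /G /D2 /E2 -exprVn -/M2' -/c2 -/c2'.
rewrite !fctE /GRing.scale/= [leLHS]mulrC.
rewrite ler_wpM2r ?exprn_ge0 ?invr_ge0 ?(ltW l0)//.
rewrite -addrA lerD2l.
(* Bounding [V x] by [lam^-1 * M2'] turns the coefficients of [G n] into [D2] and [E2]. *)
have -> : c2' * lam^-1 * M2' + c2 * (1 - lam^-1) * M2' * n%:R =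
  (c2' + c2 * (lam - 1) * n%:R) * (lam^-1 * M2') by field; rewrite gt_eqF.
rewrite ler_wpM2l//; last exact: le_trans (Vh x) h_M2.
by rewrite addr_ge0// !mulr_ge0// subr_ge0 ltW.
Qed.

End regeneration.

(** * Transition kernels and the Markov chain *)

(** The integral of a nonnegative function is a supremum over the simple functions below it, hence
    monotone for arbitrary functions. This allows a comparison with the integral of [hitting_time]
    without establishing its measurability. *)
Lemma ge0_le_integral_set d (X : measurableType d) (R : realType)
    (mu : {measure set X -> \bar R}) (f g : X -> \bar R) :
  (forall x, 0 <= f x)%E -> (forall x, f x <= g x)%E ->
  (\int[mu]_x f x <= \int[mu]_x g x)%E.
Proof.
move=> f0 fg; have g0 x : (0 <= g x)%E by exact: le_trans (fg x).
rewrite !ge0_integralTE//; apply: le_ereal_sup => _ [h hf <-].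
by exists h => // x; exact: le_trans (fg x).
Qed.

Section functionals.
Context d (X : measurableType d) (R : realType).

Lemma prob_functional_integral (mu : {measure set X -> \bar R}) :
  mu setT = 1%E -> prob_functional (fun f => \int[mu]_x f x).
Proof.
move=> mu1; have mufin : (mu setT < +oo)%E by rewrite mu1 ltry.
split; first exact: sigma_linear_integral.
  by move=> f _ f0; apply: Rintegral_ge0 => x _; exact: f0.
by rewrite Rintegral_cst// mu1/= mul1r.
Qed.

Lemma bmf_comp d' (Y : measurableType d') (phi : X -> Y) (f : Y -> R) :
  measurable_fun setT phi -> bmf f -> bmf (f \o phi).
Proof.
move=> mphi [mf [c fc]]; split; last by exists c => x; exact: fc.
exact: measurableT_comp.
Qed.

Lemma sigma_linear_comp_fun d' (Y : measurableType d') (phi : X -> Y)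
    (L : (X -> R) -> R) : measurable_fun setT phi -> sigma_linear L ->
  sigma_linear (fun f : Y -> R => L (f \o phi)).
Proof.
move=> mphi sL; split=> [a f g bf bg|u f [mu [c uc] cv]].
  have -> : (a *: f + g) \o phi = a *: (f \o phi) + (g \o phi) by [].
  by rewrite (sl_lin sL)//; exact: bmf_comp.
apply: (sl_cvg sL); split=> [n||x].
- exact: measurableT_comp.
- by exists c => n x; exact: uc.
- exact: cv.
Qed.

Lemma bmf_Lfun2 (mu : probability X R) (f : X -> R) : bmf f -> f \in Lfun mu 2%:E.
Proof.
move=> bf; rewrite inE/=; apply/andP; split; apply: mem_set; first exact: bf.1.
rewrite /= /finite_norm unlock poweR_lty//.
have bff : bmf (f * f) by exact: bmfM.
have mu1 : (mu setT < +oo)%E by rewrite probability_setT ltry.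
rewrite (eq_integral (fun x => ((f * f) x)%:E)) ?(integral_bmf mu1 bff) ?ltry// => x _.
by rewrite /= powR_mulrn// real_normK ?num_real// expr2.
Qed.

End functionals.

(** * The one-step operator on bounded functions *)

Section transition_operator.
Context d (X : measurableType d) (R : realType) (P : R.-pker X ~> X).

Definition transition (f : X -> R) (x : X) : R := \int[P x]_y f y.

Let Pfin x : (P x setT < +oo)%E. Proof. by rewrite prob_kernel ltry. Qed.

Lemma transition_prob x : prob_functional (transition ^~ x).
Proof. by apply: prob_functional_integral; exact: prob_kernel. Qed.

Lemma transition_indic B x : measurable B -> (transition \1_B x)%:E = P x B.
Proof.
move=> mB; rewrite /transition Rintegral_indic// fineK//.
rewrite ge0_fin_numE// (le_lt_trans _ (Pfin x))//.
by apply: le_measure; [exact: mem_set|exact/mem_set/measurableT|exact: subsetT].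
Qed.

Lemma transition_ge0 f : bmf f -> (forall x, 0 <= f x) -> forall x, 0 <= transition f x.
Proof. by move=> bf f0 x; exact: (pf_ge0 (transition_prob x)). Qed.

Lemma transition_norm f c x : bmf f -> (forall y, `|f y| <= c) ->
  `|transition f x| <= c.
Proof. exact: (pf_norm_cst (transition_prob x)). Qed.

Lemma measurable_transition f : bmf f -> measurable_fun setT (transition f).
Proof.
have ge0 : forall f, bmf f -> (forall x, 0 <= f x) ->
    measurable_fun setT (transition f).
  apply: bmf_ge0_ind => [B mB|a g k a0 bg bk mg mk|u g ug mu].
  - apply/measurable_EFinP.
    rewrite (_ : EFin \o _ = P ^~ B); first exact: measurable_kernel.
    by apply/funext => x /=; rewrite transition_indic.
  - rewrite (_ : transition _ = a *: transition g + transition k).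
      by apply: measurable_funD => //; exact: measurable_funM.
    by apply/funext => x; rewrite (sl_lin (pf_sl (transition_prob x))).
  - apply: (measurable_fun_cvg mu) => x _.
    exact: (sl_cvg (pf_sl (transition_prob x)) ug).
move=> bf; have [mf [c fc]] := bf.
have bc : bmf (cst c : X -> R) by exact: bmf_cst.
rewrite (_ : transition f = transition (f + cst c) - transition (cst c)).
  apply: measurable_funB; last first.
    rewrite (_ : transition _ = cst c); first exact: measurable_cst.
    by apply/funext => x; rewrite (pf_cst (transition_prob x)).
  apply: ge0 => [|x]; first exact: bmfD.
  by rewrite fctE -lerBlDr sub0r; have := fc x; rewrite ler_norml => /andP[].
by apply/funext => x; rewrite !fctE (slD (pf_sl (transition_prob x)))// addrK.
Qed.

Lemma transition_kernel_op : kernel_op transition.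
Proof.
split=> [f bf|x|f bf f0 x|x].
- split; first exact: measurable_transition.
  by have [_ [c fc]] := bf; exists c => x; exact: transition_norm.
- exact: (pf_sl (transition_prob x)).
- exact: transition_ge0.
- by rewrite (pf1 (transition_prob x)).
Qed.

Lemma transition1 : transition (cst 1) = cst 1.
Proof. by apply/funext => x; rewrite (pf1 (transition_prob x)). Qed.

Lemma invariant_transition (pi : probability X R) f :
  invariant_probability P pi -> bmf f -> \int[pi]_x transition f x = \int[pi]_x f x.
Proof.
move=> Ppi; have ppi := prob_functional_integral (probability_setT pi).
apply: (sl_uniq (L1 := fun f => \int[pi]_x transition f x)
  (L2 := fun f => \int[pi]_x f x)).
- exact: (sigma_linear_comp transition_kernel_op (pf_sl ppi)).
- exact: (pf_sl ppi).
move=> B mB; rewrite Rintegral_indic//.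
transitivity (fine (\int[pi]_x P x B)%E); last by rewrite Ppi.
by rewrite /Rintegral; congr fine; apply: eq_integral => x _; rewrite transition_indic.
Qed.

(** Reversibility on rectangles [F * G] is the identity for two indicators; uniqueness of
    sigma-linear functionals extends it to one argument at a time. *)
Lemma reversible_transition (pi : probability X R) f g :
  reversible P pi -> bmf f -> bmf g ->
  \int[pi]_x (transition f * g) x = \int[pi]_x (f * transition g) x.
Proof.
move=> Prev; have ppi := prob_functional_integral (probability_setT pi).
have kP := transition_kernel_op.
have sl1 k : bmf k -> sigma_linear (fun f => \int[pi]_x (k * f) x).
  by move=> bk; exact: (sigma_linear_weight bk (pf_sl ppi)).
have sl2 k : bmf k -> sigma_linear (fun f => \int[pi]_x (k * transition f) x).
  by move=> bk; exact: (sigma_linear_comp kP (sl1 k bk)).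
have weightE F G : measurable F -> measurable G ->
    (\int[pi]_x (\1_F * transition \1_G) x)%:E =
    (\int[pi]_x P x (xsection (F `*` G) x))%E.
  move=> mF mG.
  have mu1 : (pi setT < +oo)%E by rewrite probability_setT ltry.
  rewrite -integral_bmf//; last first.
    by apply: bmfM; [exact: bmf_indic|apply: (ko_bmf kP); exact: bmf_indic].
  apply: eq_integral => x _; rewrite fctE EFinM transition_indic// indicE.
  have [xF|xF] := boolP (x \in F); first by rewrite mul1e in_xsectionX.
  by rewrite mul0e notin_xsectionX// measure0.
have weightE' F G : measurable F -> measurable G ->
    (\int[pi]_x P x (ysection (F `*` G) x))%E =
    (\int[pi]_x P x (xsection (G `*` F) x))%E.
  move=> mF mG; apply: eq_integral => x _.
  have [xF|xF] := boolP (x \in G); first by rewrite in_xsectionX// in_ysectionX.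
  by rewrite notin_xsectionX// notin_ysectionX.
have indic F G : measurable F -> measurable G ->
    \int[pi]_x (\1_F * transition \1_G) x = \int[pi]_x (\1_G * transition \1_F) x.
  move=> mF mG; apply: EFin_inj; rewrite !weightE// Prev ?weightE'//.
  exact: measurableX.
have half F k : measurable F -> bmf k ->
    \int[pi]_x (\1_F * transition k) x = \int[pi]_x (transition \1_F * k) x.
  move=> mF; have bF : bmf (\1_F : X -> R) by exact: bmf_indic.
  apply: (sl_uniq (sl2 _ bF) (sl1 _ (ko_bmf kP bF))) => G mG.
  by rewrite indic// mulrC.
move=> bf bg; apply: (sl_uniq (sl1 _ (ko_bmf kP bf)) (sl2 _ bf) _ bg) => G mG.
by rewrite mulrC half// mulrC.
Qed.

Lemma nonneg_definite_transition (pi : probability X R) f :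
  nonneg_definite P pi -> bmf f -> 0 <= \int[pi]_x (f * transition f) x.
Proof.
move=> Ppos bf; have mu1 : (pi setT < +oo)%E by rewrite probability_setT ltry.
have bTf := ko_bmf transition_kernel_op bf.
have := Ppos f (bmf_Lfun2 pi bf).
rewrite -lee_fin -integral_bmf//; last exact: bmfM.
congr (_ <= _)%E; apply: eq_integral => x _.
by rewrite integral_bmf// fctE EFinM.
Qed.

(** The difference of the two sides is sigma-linear in [f] and nonnegative on indicators. *)
Lemma minorization_transition (A : set X) (delta : R) (nu : probability X R) f x :
  0 < delta ->
  (forall (x : X) (B : set X), measurable B ->
     ((delta * \1_A x)%:E * nu B <= P x B)%E) ->
  bmf f -> (forall y, 0 <= f y) ->
  delta * \1_A x * (\int[nu]_y f y) <= transition f x.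
Proof.
move=> d0 minor bf f0.
have pnu := prob_functional_integral (probability_setT nu).
pose L f := (- (delta * \1_A x)) * \int[nu]_y f y + transition f x.
have sL : sigma_linear L.
  by apply: sigma_linear_lin; [exact: (pf_sl pnu)|exact: (pf_sl (transition_prob x))].
suff : 0 <= L f by rewrite /L mulNr addrC subr_ge0.
apply: (sl_ge0 sL) => // B mB.
rewrite /L mulNr addrC subr_ge0 -lee_fin transition_indic// EFinM.
rewrite Rintegral_indic// fineK ?minor//.
exact: fin_num_measure.
Qed.

End transition_operator.

(** * The law of the chain and the hitting time of [A] *)

Section chain.
Context (R : realType) (d dO : measure_display).
Context (X : measurableType d) (Omega : measurableType dO).
Context (P : R.-pker X ~> X) (Pr : X -> probability Omega R).
Context (Phi : nat -> {mfun Omega >-> X}).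
Hypothesis Phi_chain : markov_chain P Pr Phi.

Let pPr x : prob_functional (fun f => \int[Pr x]_w f w).
Proof. by apply: prob_functional_integral; exact: probability_setT. Qed.

Let Prfin x : (Pr x setT < +oo)%E. Proof. by rewrite probability_setT ltry. Qed.

Let mPhi n : measurable_fun setT (Phi n).
Proof. exact: measurable_funP. Qed.

Lemma natural_filtration_measurable n F : natural_filtration Phi n F -> measurable F.
Proof.
apply: smallest_sub => [|_ [k _ [B mB <-]]]; first exact: sigma_algebra_measurable.
exact: mPhi.
Qed.

Lemma markov_property x n F f : natural_filtration Phi n F -> bmf f ->
  \int[Pr x]_w (\1_F w * f (Phi n.+1 w)) =
  \int[Pr x]_w (\1_F w * transition P f (Phi n w)).
Proof.
move=> nF; have mF := natural_filtration_measurable nF.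
have bF : bmf (\1_F : Omega -> R) by exact: bmf_indic.
have kP := transition_kernel_op P.
have slF k : sigma_linear (fun f : X -> R => \int[Pr x]_w (\1_F * (f \o Phi k)) w).
  exact: (sigma_linear_comp_fun (mPhi k) (sigma_linear_weight bF (pf_sl (pPr x)))).
apply: (sl_uniq (slF n.+1) (sigma_linear_comp kP (slF n))) => B mB.
have bB : bmf (\1_B : X -> R) by exact: bmf_indic.
have bTB : bmf (transition P \1_B) by exact: (ko_bmf kP).
have b1 := bmfM bF (bmf_comp (mPhi n.+1) bB).
have b2 := bmfM bF (bmf_comp (mPhi n) bTB).
apply: EFin_inj; rewrite -!(integral_bmf (Prfin x))//.
transitivity (Pr x (F `&` Phi n.+1 @^-1` B)).
  rewrite -[X in Pr x X]setIT -integral_indic//; last first.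
    by apply: measurableI => //; rewrite -[X in measurable X]setTI; exact: mPhi.
  by apply: eq_integral => w _; rewrite indicI.
rewrite (chain_step Phi_chain _ nF mB) [LHS]integral_mkcond; apply: eq_integral => w _.
rewrite patchE !fctE indicE; case: ifPn => wF; last by rewrite mul0r.
by rewrite mul1r /= transition_indic.
Qed.

Lemma chain_mean x n f : bmf f ->
  \int[Pr x]_w f (Phi n w) = iter n (transition P) f x.
Proof.
elim: n f => [|n IH] f bf.
  have sl0 : sigma_linear (fun f : X -> R => \int[Pr x]_w (f \o Phi 0%N) w).
    exact: (sigma_linear_comp_fun (mPhi 0) (pf_sl (pPr x))).
  have sld : sigma_linear (fun f : X -> R => f x) by split=> // u g [].
  apply: (sl_uniq sl0 sld) bf => B mB.
  transitivity (fine (Pr x (Phi 0%N @^-1` B))).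
    rewrite -Rintegral_indic//.
    by rewrite -[X in measurable X]setTI; exact: mPhi.
  by rewrite (chain_start Phi_chain)// diracE indicE.
have nT : natural_filtration Phi n setT.
  exact: (@measurableT _ (g_sigma_algebraType _)).
rewrite iterSr -IH; last by apply: (ko_bmf (transition_kernel_op P)).
have := markov_property x nT bf; rewrite indicT.
by under eq_Rintegral do rewrite mul1r; under [in RHS]eq_Rintegral do rewrite mul1r.
Qed.

Variable A : set X.
Hypothesis mA : measurable A.

(** The event $\{\sigma_A>n\}$, in recursive form to suit the filtration and the Markov property. *)
Fixpoint avoid n : set Omega :=
  if n is m.+1 then avoid m `&` Phi n @^-1` (~` A) else Phi 0%N @^-1` (~` A).

Lemma avoidP n w : avoid n w <-> forall k, (k <= n)%N -> ~ A (Phi k w).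
Proof.
elim: n => [|n IH] /=.
  by split=> [h k|]; [rewrite leqn0 => /eqP ->|apply].
split=> [[/IH h1 h2] k|h].
  by rewrite leq_eqVlt => /orP[/eqP->//|]; exact: h1.
by split; [apply/IH => k kn; apply: h; exact: leqW|exact: h].
Qed.

Lemma natural_filtration_avoid n : natural_filtration Phi n (avoid n).
Proof.
have gen m k : (k <= m)%N -> natural_filtration Phi m (Phi k @^-1` (~` A)).
  move=> km; apply: sub_sigma_algebra; exists k => //.
  by exists (~` A); [exact: measurableC|rewrite setTI].
have mono m F : natural_filtration Phi m F -> natural_filtration Phi m.+1 F.
  apply: sub_sigma_algebra2 => G [k /= km Gk]; exists k => //=; exact: leqW.
elim: n => [|n IH] /=; first exact: gen.
apply: (@measurableI _ (g_sigma_algebraType _)); first exact: mono.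
exact: gen.
Qed.

(** The Markov property trades one iteration of [survival] for one more step of avoidance: [shift]
    keeps the sum of the two indices constant, and [walk] follows it from time 0 to time [n]. *)
Lemma survivalE x n : survival (transition P) A n x = \int[Pr x]_w \1_(avoid n) w.
Proof.
have kP := transition_kernel_op P.
have bs m : bmf (survival (transition P) A m) by exact: survival_bmf.
have out m y : A y -> survival (transition P) A m y = 0.
  move=> Ay; case: m => [|m].
    by rewrite /survival/= indicE in_setC mem_set.
  by rewrite survivalS indicE in_setC mem_set//= mul0r.
have shift k m :
    \int[Pr x]_w (\1_(avoid k) w * survival (transition P) A m.+1 (Phi k w)) =
    \int[Pr x]_w (\1_(avoid k.+1) w * survival (transition P) A m (Phi k.+1 w)).
  transitivity (\int[Pr x]_w (\1_(avoid k) w *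
      transition P (survival (transition P) A m) (Phi k w))).
    apply: eq_Rintegral => w _.
    rewrite indicE; have [/set_mem/avoidP wk|_] := boolP (w \in avoid k);
      last by rewrite !mul0r.
    by rewrite !mul1r survivalS indicE in_setC memNset ?mul1r//; exact: wk.
  rewrite -markov_property//; last exact: natural_filtration_avoid.
  apply: eq_Rintegral => w _.
  rewrite [avoid k.+1]/= indicI.
  have [Aw|nAw] := pselect (A (Phi k.+1 w)); first by rewrite out// !mulr0.
  by rewrite [X in _ * X * _]indicE mem_set// mulr1.
have walk m k :
    \int[Pr x]_w (\1_(avoid k) w * survival (transition P) A m (Phi k w)) =
    \int[Pr x]_w (\1_(avoid (k + m)) w *
      survival (transition P) A 0 (Phi (k + m)%N w)).
  elim: m k => [|m IH] k; first by rewrite addn0.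
  by rewrite shift IH addSnnS.
have := chain_mean x 0 (bs n); rewrite /= => <-.
transitivity (\int[Pr x]_w (\1_(avoid 0) w * survival (transition P) A n (Phi 0%N w))).
  apply: eq_Rintegral => w _.
  have [Aw|nAw] := pselect (A (Phi 0%N w)); first by rewrite out// mulr0.
  by rewrite indicE mem_set// mul1r.
rewrite walk add0n; apply: eq_Rintegral => w _.
rewrite indicE; have [/set_mem/avoidP wk|_] := boolP (w \in avoid n);
    last by rewrite mul0r.
by rewrite /survival/= indicE in_setC memNset ?mul1r//; exact: wk.
Qed.

(** The sum counts the [i < n] with $\sigma_A>i$, so it is $\min(n,\sigma_A)$, finite even when [A]
    is never hit. *)
Lemma hitting_time_ge n w :
  ((\sum_(i < n) \1_(avoid i) w : R)%:E <= hitting_time R Phi A w)%E.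
Proof.
apply: le_ereal_inf_tmp => _ [m /= Am <-].
rewrite lee_fin.
have [nm|mn] := leqP n m.
  rewrite (@le_trans _ _ (\sum_(i < n) (1 : R)))//.
    by apply: ler_sum => i _; rewrite indicE; case: (_ \in _).
  by rewrite sumr_const card_ord -[_ *+ _]/(n%:R) ler_nat.
rewrite (bigID (fun i : 'I_n => (i < m)%N))/= [X in _ + X]big1 ?addr0; last first.
  move=> i; rewrite -leqNgt => mi.
  by rewrite indicE memNset// => /avoidP /(_ _ mi).
rewrite (@le_trans _ _ (\sum_(i < n | (i < m)%N) (1 : R)))//.
  by apply: ler_sum => i _; rewrite indicE; case: (_ \in _).
rewrite -(big_ord_widen _ (fun=> 1))//; last exact: ltnW.
by rewrite sumr_const card_ord.
Qed.

Lemma survival_sum_le x (M : R) n :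
  (\int[Pr x]_w hitting_time R Phi A w <= M%:E)%E ->
  \sum_(i < n) survival (transition P) A i x <= M.
Proof.
move=> hM; rewrite -lee_fin (le_trans _ hM)//.
have ba i : bmf (\1_(avoid i) : Omega -> R).
  apply: bmf_indic; apply: natural_filtration_measurable.
  exact: natural_filtration_avoid.
under eq_bigr do rewrite survivalE.
have -> : \sum_(i < n) \int[Pr x]_w \1_(avoid i) w =
    \int[Pr x]_w (\sum_(i < n) (\1_(avoid i) : Omega -> R)) w.
  elim: n => [|n IH]; first by rewrite !big_ord0 (sl0 (pf_sl (pPr x))).
  rewrite !big_ord_recr/= IH -(slD (pf_sl (pPr x)))//.
  exact: (bmf_sum n ba).
rewrite -(integral_bmf (Prfin x)); last exact: (bmf_sum n ba).
apply: ge0_le_integral_set => w.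
  by rewrite lee_fin fct_sumE; apply: sumr_ge0 => i _; rewrite indicE.
rewrite fct_sumE; exact: hitting_time_ge.
Qed.

End chain.

(* Since inverses in \bar R satisfy 0^-1 = +oo, the bound e^{1/M} is +oo when
   M = 0, i.e. when A = X. *)
Theorem theorem3p3 (R : realType) (d dO : measure_display)
  (X : measurableType d) (Omega : measurableType dO)
  (P : R.-pker X ~> X) (Pr : X -> probability Omega R)
  (Phi : nat -> {mfun Omega >-> X}) (pi : probability X R)
  (X_countably_generated : countably_generated X)
  (Phi_chain : markov_chain P Pr Phi)
  (pi_invariant : unique_invariant_probability P pi)
  (P_irreducible : irreducible_wrt (nstep Pr Phi) pi)
  (P_dominated : forall (n : nat) (x : X), (0 < n)%N -> nstep Pr Phi n x `<< pi)
  (P_reversible : reversible P pi)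
  (P_nonneg_definite : nonneg_definite P pi)
  (A : set X) (A_measurable : measurable A) (A_pos : (0 < pi A)%E)
  (delta : R) (delta_gt0 : 0 < delta) (nu : probability X R)
  (minorization : forall (x : X) (B : set X), measurable B ->
     ((delta * \1_A x)%:E * nu B <= P x B)%E)
  (M : \bar R)
  (M_def : M = ereal_sup (range (fun x => \int[Pr x]_w hitting_time R Phi A w)%E))
  (M_finite : (M < +oo)%E)
  (lam : R) (lam_gt1 : 1 < lam) (lam_lt_exp : (lam%:E < expeR M^-1)%E)
  (lam_lt : lam < (1 + delta * lam) * (1 - fine M * ln lam))
  (n : nat) :
  (kernel_dist (nstep Pr Phi n) pi <=
   ((D2 delta (fine (pi A)) (fine M) lam +
     E2 delta (fine (pi A)) (fine M) lam * n%:R) * lam ^- n)%:E)%E.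
Proof.
have kP := transition_kernel_op P.
have ppi := prob_functional_integral (probability_setT pi).
have pnu := prob_functional_integral (probability_setT nu).
have piAE : \int[pi]_x \1_A x = fine (pi A) by exact: Rintegral_indic.
have piA_gt0 : 0 < \int[pi]_x \1_A x.
  by rewrite piAE fine_gt0// A_pos (le_lt_trans (probability_le1 _ _))// ltry.
have hitM x : (\int[Pr x]_w hitting_time R Phi A w <= M)%E.
  by rewrite M_def; apply: ereal_sup_ubound; exists x.
(* [fine M] is the true value: [M] is below [+oo] and dominates the integral of a nonnegative
   function. *)
have hit_sum m x : \sum_(i < m) survival (transition P) A i x <= fine M.
  apply: (survival_sum_le Phi_chain A_measurable); rewrite fineK// fin_real//.
  rewrite M_finite andbT (lt_le_trans _ (hitM x))// (@lt_le_trans _ _ 0%E)//.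
  apply: integral_ge0 => w _; apply: le_ereal_inf_tmp => _ [k _ <-].
  by rewrite lee_fin.
apply: ge_ereal_sup => _ [x _ <-].
apply: ge_ereal_sup => _ [f [mf f1] <-].
have bf : bmf f by split => //; exists 1.
have bfn : bmf (f \o Phi n) by exact: bmf_comp.
have Pr_fin : (Pr x setT < +oo)%E by rewrite probability_setT ltry.
have pi_fin : (pi setT < +oo)%E by rewrite probability_setT ltry.
have -> : (\int[nstep Pr Phi n x]_y (f y)%:E = (iter n (transition P) f x)%:E)%E.
  rewrite -(chain_mean Phi_chain)// -(integral_bmf Pr_fin bfn).
  rewrite integral_distribution//; first exact/measurable_EFinP.
  exact: (bmf_integrable Pr_fin bfn).
rewrite (integral_bmf pi_fin bf) -EFinB abse_EFin lee_fin -piAE.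
apply: (regeneration_bound (nu := fun f => \int[nu]_x f x)) => //.
- exact: transition1.
- by move=> g y bg g0; exact: minorization_transition.
- by move=> g bg; exact: (invariant_transition pi_invariant.1).
- by move=> g k bg bk; exact: reversible_transition.
- by move=> g bg; exact: nonneg_definite_transition.
Qed.
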